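(* Let $\Gamma$ be a connected Coxeter graph, not necessarily of spherical type. Then the group $\mathrm{KVA}[\Gamma]$ is indecomposable.
   Context: A Coxeter matrix on a countable (finite or infinite) set $S$ is a symmetric matrix $(m_{s,t})_{s,t\in S}$ with $m_{s,s}=1$ for all $s$ and $m_{s,t}\in\{2,3,4,\dots\}\cup\{\infty\}$ for $s\neq t$. It is encoded by the Coxeter graph $\Gamma$: the simplicial graph with vertex set $S$ in which distinct $s,t$ are joined by an edge iff $m_{s,t}\ge 3$, the edge being labeled by $m_{s,t}$ when $m_{s,t}\geq 4$ (including $\infty$). The Coxeter group $\mathrm{W}[\Gamma]$ has generating set $S$ and relations $s^2=\mathrm{id}$ for all $s\in S$ and $(st)^{m_{s,t}}=\mathrm{id}$ for all $s\ne t$ with $m_{s,t}\neq\infty$. $\Gamma$ is of spherical type if $S$ is finite and $\mathrm{W}[\Gamma]$ is finite. The virtual Artin group $\mathrm{VA}[\Gamma]$ is the group with generators $\{\sigma_s : s\in S\}\cup\{\tau_s : s\in S\}$ and relations: (VA1) $\cdots\sigma_s\sigma_t\sigma_s=\cdots\sigma_t\sigma_s\sigma_t$ (alternating words, both sides with $m_{s,t}$ letters, the left one ending in $\sigma_s$, the right one ending in $\sigma_t$) for all $s\ne t$ with $m_{s,t}\neq\infty$; (VA2) $\cdots\tau_s\tau_t\tau_s=\cdots\tau_t\tau_s\tau_t$ (both sides with $m_{s,t}$ letters) for all $s\neq t$ with $m_{s,t}\ne\infty$, and $\tau_s^2=\mathrm{id}$ for all $s\in S$; (VA3) for all $s\ne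 t$ with $m_{s,t}\neq\infty$, $P\,\sigma_t=\sigma_r\,P$, where $P=\cdots\tau_s\tau_t\tau_s$ is the alternating word in $\tau_s,\tau_t$ with $m_{s,t}-1$ letters ending in $\tau_s$, and $r=t$ if $m_{s,t}$ is even, $r=s$ if $m_{s,t}$ is odd. $\mathrm{KVA}[\Gamma]$ is the kernel of the homomorphism $\pi_K:\mathrm{VA}[\Gamma]\to\mathrm{W}[\Gamma]$ with $\pi_K(\tau_s)=s$ and $\pi_K(\sigma_s)=\mathrm{id}$ for all $s\in S$. A group $G$ is decomposable if it is the (internal) direct product $G=H\times K$ of two proper subgroups $H,K$, and indecomposable otherwise. *)

(* Defs.v *)
From HB Require Import structures.
From mathcomp Require Import all_boot.
From mathcomp Require Import boolp classical_sets.

Set Implicit Arguments.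
Unset Strict Implicit.
Unset Printing Implicit Defensive.

Local Open Scope group_scope.
Local Open Scope classical_set_scope.
Local Open Scope quotient_scope.

(* A letter (x, b) stands for x if b = false and for x^-1 if b = true. *)
Definition word (X : Type) := seq (X * bool).

Definition pos_word X (s : seq X) : word X := [seq (x, false) | x <- s].

Definition inv_word X (w : word X) : word X :=
  rev [seq (l.1, ~~ l.2) | l <- w].

(* R u v is read as the relation "u = v" of the presentation < X | R >. *)
Section PresentedGroup.
Variables (X : countType) (R : word X -> word X -> Prop).

Inductive pres_eq : word X -> word X -> Prop :=
| pres_rel u v of R u v : pres_eq u v
| pres_cancel x b : pres_eq [:: (x, b); (x, ~~ b)] [::]
| pres_cat u u' v v' of pres_eq u u' & pres_eq v v' :
    pres_eq (u ++ v) (u' ++ v')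
| pres_refl u : pres_eq u u
| pres_sym u v of pres_eq u v : pres_eq v u
| pres_trans u v w of pres_eq u v & pres_eq v w : pres_eq u w.

Definition pres_eqb : rel (word X) := fun u v => `[< pres_eq u v >].

Lemma pres_eqb_refl : reflexive pres_eqb.
Proof. by move=> u; apply/asboolP; exact: pres_refl. Qed.

Lemma pres_eqb_sym : symmetric pres_eqb.
Proof. by move=> u v; apply/asboolP/asboolP => /pres_sym. Qed.

Lemma pres_eqb_trans : transitive pres_eqb.
Proof.
by move=> v u w /asboolP uv /asboolP vw; apply/asboolP; exact: pres_trans vw.
Qed.

Canonical pres_equiv := EquivRel pres_eqb pres_eqb_refl pres_eqb_sym
  pres_eqb_trans.

Definition presented := {eq_quot pres_equiv}.

HB.instance Definition _ := Choice.on presented.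
HB.instance Definition _ := Quotient.on presented.

Definition wclass (w : word X) : presented := \pi_presented w.

Definition gen (x : X) : presented := wclass [:: (x, false)].

Lemma wclassP u v : wclass u = wclass v <-> pres_eq u v.
Proof. by split=> [/eqmodP/asboolP | uv] //; apply/eqmodP/asboolP. Qed.

Lemma wclass_repr (x : presented) : wclass (repr x) = x.
Proof. exact: reprK. Qed.

Lemma repr_wclass w : pres_eq (repr (wclass w)) w.
Proof. by apply/wclassP; exact: wclass_repr. Qed.

Lemma inv_word_cat (u v : word X) :
  inv_word (u ++ v) = inv_word v ++ inv_word u.
Proof. by rewrite /inv_word map_cat rev_cat. Qed.

Lemma inv_wordK : involutive (@inv_word X).
Proof.
move=> w; rewrite /inv_word map_rev revK -map_comp map_id_in // => -[x b] _ /=.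
by rewrite negbK.
Qed.

Lemma pres_mulV w : pres_eq (w ++ inv_word w) [::].
Proof.
elim: w => [|[x b] w IHw]; first exact: pres_refl.
apply: pres_trans _ (pres_cancel x b).
have -> : ((x, b) :: w) ++ inv_word ((x, b) :: w) =
    [:: (x, b)] ++ (w ++ inv_word w) ++ [:: (x, ~~ b)].
  by rewrite -[(x, b) :: w]cat1s inv_word_cat -!catA.
exact: pres_cat (pres_refl _) (pres_cat IHw (pres_refl _)).
Qed.

Lemma pres_inv u v : pres_eq u v -> pres_eq (inv_word u) (inv_word v).
Proof.
move=> uv; have h1 := pres_cat (pres_refl (inv_word u)) (pres_mulV v).
have h2 := pres_mulV (inv_word u); rewrite inv_wordK in h2.
have h3 := pres_cat (pres_cat (pres_refl (inv_word u)) uv)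
  (pres_refl (inv_word v)).
rewrite cats0 in h1; rewrite -[in X in pres_eq _ X]catA in h3.
have h4 := pres_cat h2 (pres_refl (inv_word v)); rewrite cat0s in h4.
exact: pres_sym (pres_trans (pres_sym h4) (pres_trans h3 h1)).
Qed.

Definition pres_mul (x y : presented) := wclass (repr x ++ repr y).
Definition pres_one := wclass [::].
Definition pres_invg (x : presented) := wclass (inv_word (repr x)).

Lemma pres_mulE u v : pres_mul (wclass u) (wclass v) = wclass (u ++ v).
Proof. by apply/wclassP; apply: pres_cat; exact: repr_wclass. Qed.

Lemma pres_invE u : pres_invg (wclass u) = wclass (inv_word u).
Proof. by apply/wclassP; apply: pres_inv; exact: repr_wclass. Qed.

Lemma pres_mulA : associative pres_mul.
Proof.
move=> x y z; rewrite -(wclass_repr x) -(wclass_repr y) -(wclass_repr z).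
by rewrite !pres_mulE catA.
Qed.

Lemma pres_mul1 : left_id pres_one pres_mul.
Proof. by move=> x; rewrite -(wclass_repr x) pres_mulE. Qed.

Lemma pres_mulr1 : right_id pres_one pres_mul.
Proof. by move=> x; rewrite -(wclass_repr x) pres_mulE cats0. Qed.

Lemma pres_mulgV : right_inverse pres_one pres_invg pres_mul.
Proof.
move=> x; rewrite -(wclass_repr x) pres_invE pres_mulE.
by apply/wclassP; exact: pres_mulV.
Qed.

Lemma pres_mulVg : left_inverse pres_one pres_invg pres_mul.
Proof.
move=> x; rewrite -(wclass_repr x) pres_invE pres_mulE; apply/wclassP.
by have := pres_mulV (inv_word (repr x)); rewrite inv_wordK.
Qed.

HB.instance Definition _ := isGroup.Build presented
  pres_mulA pres_mul1 pres_mulr1 pres_mulVg pres_mulgV.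

Lemma wclass_cat u v : wclass (u ++ v) = wclass u * wclass v.
Proof. by rewrite -pres_mulE. Qed.

Lemma wclass_nil : wclass [::] = 1.
Proof. by []. Qed.

Lemma wclass_inv u : wclass (inv_word u) = (wclass u)^-1.
Proof. by rewrite -pres_invE. Qed.

Lemma wclass_pos s : wclass (pos_word s) = \prod_(x <- s) gen x.
Proof.
elim: s => [|x s IHs]; first by rewrite big_nil.
by rewrite big_cons -IHs -wclass_cat.
Qed.

Lemma wclass_rel u v : R u v -> wclass u = wclass v.
Proof. by move=> uv; apply/wclassP; exact: pres_rel. Qed.

End PresentedGroup.

Section Lift.
Variables (X : countType) (R : word X -> word X -> Prop) (G : groupType).
Variable f : X -> G.

Definition word_eval (w : word X) : G :=
  \prod_(l <- w) (if l.2 then (f l.1)^-1 else f l.1).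

Hypothesis fR : forall u v, R u v -> word_eval u = word_eval v.

Lemma word_eval_cat u v : word_eval (u ++ v) = word_eval u * word_eval v.
Proof. by rewrite /word_eval big_cat. Qed.

Lemma word_eval_pos s : word_eval (pos_word s) = \prod_(x <- s) f x.
Proof. by rewrite /word_eval big_map. Qed.

Lemma word_eval_pres_eq u v : pres_eq R u v -> word_eval u = word_eval v.
Proof.
elim=> {u v} [u v /fR //|x b|u u' v v' _ eu _ ev|//|u v _ ->//|u v w _ -> _ //].
- rewrite /word_eval big_cons big_seq1 big_nil /=.
  by case: b; rewrite /= ?mulgV ?mulVg.
- by rewrite !word_eval_cat eu ev.
Qed.

Definition pres_lift of (forall u v, R u v -> word_eval u = word_eval v) :=
  fun x : presented R => word_eval (repr x).

Lemma pres_lift_wclass w : pres_lift fR (wclass R w) = word_eval w.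
Proof. exact/word_eval_pres_eq/repr_wclass. Qed.

Lemma pres_lift_gen x : pres_lift fR (gen R x) = f x.
Proof. by rewrite pres_lift_wclass /word_eval big_seq1. Qed.

Lemma pres_liftM : {morph pres_lift fR : x y / x * y}.
Proof.
move=> x y; rewrite -(wclass_repr x) -(wclass_repr y) -wclass_cat.
by rewrite !pres_lift_wclass word_eval_cat.
Qed.

Lemma pres_lift1 : pres_lift fR 1 = 1.
Proof. by rewrite -(wclass_nil R) pres_lift_wclass /word_eval big_nil. Qed.

HB.instance Definition _ :=
  isUMagmaMorphism.Build _ _ (pres_lift fR) (pres_lift1, pres_liftM).
End Lift.

Section CoxeterGraph.
Variable S : countType.

(* None stands for the entry infinity. *)
Record coxeter_matrix := CoxeterMatrix {
  cox_m :> S -> S -> option nat;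
  cox_m_sym : forall s t, cox_m s t = cox_m t s;
  cox_m_diag : forall s, cox_m s s = Some 1%N;
  cox_m_offdiag : forall s t k, s != t -> cox_m s t = Some k -> (2 <= k)%N
}.

Variable m : coxeter_matrix.

Definition cox_edge : rel S := fun s t =>
  (s != t) && (if m s t is Some k then (3 <= k)%N else true).

Definition cox_connected : Prop :=
  forall s t : S, exists2 p : seq S, path cox_edge s p & last s p = t.
End CoxeterGraph.

(* The alternating word "... x y x" with n letters, ending in x. *)
Fixpoint alt X (x y : X) (n : nat) : seq X :=
  if n is n'.+1 then rcons (alt y x n') x else [::].

Section CoxeterGroup.
Variables (S : countType) (m : coxeter_matrix S).

Inductive cox_rel : word S -> word S -> Prop :=
| cox_sq s : cox_rel (pos_word [:: s; s]) [::]
| cox_pow s t k of s != t & m s t = Some k :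
    cox_rel (pos_word (flatten (nseq k [:: s; t]))) [::].

Definition cox_group : groupType := presented cox_rel.

Definition cox_gen (s : S) : cox_group := gen cox_rel s.

Lemma cox_genK s : cox_gen s * cox_gen s = 1.
Proof.
by have := wclass_rel (cox_sq s); rewrite wclass_pos !big_cons big_nil mulg1.
Qed.

Lemma cox_genKl s x : cox_gen s * (cox_gen s * x) = x.
Proof. by rewrite mulgA cox_genK mul1g. Qed.

Lemma cox_gen_pow s t k :
  s != t -> m s t = Some k -> (cox_gen s * cox_gen t) ^+ k = 1.
Proof.
move=> st mk; have := wclass_rel (cox_pow st mk); rewrite wclass_pos => E.
apply: etrans E; elim: k {mk} => [|k IHk]; first by rewrite big_nil.
by rewrite expgS IHk /= !big_cons mulgA.
Qed.

Lemma cox_dihedral s t k :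
  (cox_gen t * cox_gen s) ^+ k * (cox_gen s * (cox_gen t * cox_gen s) ^+ k)
  = cox_gen s.
Proof.
elim: k => [|k IHk]; first by rewrite mul1g mulg1.
rewrite [X in X * _]expgSr [X in _ * (_ * X)]expgS -[RHS]IHk -!mulgA.
by congr (_ * _); rewrite !cox_genKl.
Qed.

Lemma cox_alt_shift s t k :
  \prod_(x <- alt s t k) cox_gen x =
  (\prod_(x <- alt t s k) cox_gen x) * (cox_gen t * cox_gen s) ^+ k.
Proof.
elim: k s t => [|k IHk] s t; first by rewrite /= big_nil mulg1.
rewrite /= -!cats1 !big_cat !big_seq1 /= (IHk s t) -!mulgA; congr (_ * _).
by rewrite expgS -!mulgA cox_genKl cox_dihedral.
Qed.

Lemma cox_braid s t k : s != t -> m s t = Some k ->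
  \prod_(x <- alt s t k) cox_gen x = \prod_(x <- alt t s k) cox_gen x.
Proof.
move=> st mk; rewrite cox_alt_shift cox_gen_pow ?mulg1 1?eq_sym //.
by rewrite cox_m_sym.
Qed.
End CoxeterGroup.

Section VirtualArtin.
Variables (S : countType) (m : coxeter_matrix S).

(* inl s is the generator sigma_s and inr s the generator tau_s. *)
Definition va_letter : countType := (S + S)%type.
Definition va_sigma (s : S) : va_letter := inl s.
Definition va_tau (s : S) : va_letter := inr s.

Inductive va_rel : word va_letter -> word va_letter -> Prop :=
| va_rel1 s t k of s != t & m s t = Some k :
    va_rel (pos_word (alt (va_sigma s) (va_sigma t) k))
           (pos_word (alt (va_sigma t) (va_sigma s) k))
| va_rel2 s t k of s != t & m s t = Some k :
    va_rel (pos_word (alt (va_tau s) (va_tau t) k))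
           (pos_word (alt (va_tau t) (va_tau s) k))
| va_rel2_sq s : va_rel (pos_word [:: va_tau s; va_tau s]) [::]
| va_rel3 s t k of s != t & m s t = Some k :
    va_rel (pos_word (rcons (alt (va_tau s) (va_tau t) k.-1) (va_sigma t)))
           (pos_word (va_sigma (if odd k then s else t)
                        :: alt (va_tau s) (va_tau t) k.-1)).

Definition VA : groupType := presented va_rel.

Definition piK_gen (l : va_letter) : cox_group m :=
  match l with inl _ => 1 | inr s => cox_gen m s end.

Lemma piK_gen_rel u v :
  va_rel u v -> word_eval piK_gen u = word_eval piK_gen v.
Proof.
have alt_map (f : S -> va_letter) s t k :
    alt (f s) (f t) k = [seq f x | x <- alt s t k].
  by elim: k s t => //= k IHk s t; rewrite IHk map_rcons.
case=> {u v} [s t k st mk|s t k st mk|s|s t k st mk]; rewrite !word_eval_pos.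
- by rewrite !alt_map !big_map !big1.
- by rewrite !alt_map !big_map; exact: cox_braid.
- by rewrite !big_cons big_nil mulg1 /word_eval big_nil; exact: cox_genK.
- by rewrite -cats1 big_cat !big_cons big_nil /= !mulg1 mul1g.
Qed.

Definition piK : VA -> cox_group m := pres_lift piK_gen_rel.

Lemma piK_monoid_morphism : monoid_morphism piK.
Proof. by split; [exact: pres_lift1 | exact: pres_liftM]. Qed.

HB.instance Definition _ :=
  isUMagmaMorphism.Build VA (cox_group m) piK piK_monoid_morphism.

Lemma piK_sigma s : piK (gen va_rel (va_sigma s)) = 1.
Proof. exact: pres_lift_gen. Qed.

Lemma piK_tau s : piK (gen va_rel (va_tau s)) = cox_gen m s.
Proof. exact: pres_lift_gen. Qed.

Definition piK_ker : {pred VA} := fun g => piK g == 1.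

Lemma piK_ker_group_closed : group_closed piK_ker.
Proof.
split=> [|x y]; rewrite !unfold_in /piK_ker ?gmulf1 ?eqxx //.
by move=> /eqP x1 /eqP y1; rewrite gmulfF /= x1 y1 divg1.
Qed.

Record KVA := InKVA { KVA_val :> VA; _ : piK_ker KVA_val }.

HB.instance Definition _ := [isSub for KVA_val].
HB.instance Definition _ := [Choice of KVA by <:].
HB.instance Definition _ :=
  SubChoice_isSubGroup.Build VA piK_ker KVA piK_ker_group_closed.
End VirtualArtin.

Section Decomposable.
Variable G : groupType.

Definition is_subgroup (H : set G) : Prop :=
  [/\ H 1, forall x y, H x -> H y -> H (x * y) & forall x, H x -> H x^-1].

Definition internal_direct_product (H K : set G) : Prop :=
  [/\ H `&` K = [set 1], forall x y, H x -> K y -> commute x y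
    & forall g, exists x y, [/\ H x, K y & g = x * y]].

Definition decomposable : Prop :=
  exists H K : set G,
    [/\ is_subgroup H, is_subgroup K, H <> setT, K <> setT
      & internal_direct_product H K].

Definition indecomposable : Prop := ~ decomposable.
End Decomposable.

(* Main.v *)
(** Let [W] be the Coxeter group of [m].  The kernel [KVA m] is an Artin group:
its standard generators are the [w sigma_s w^-1], indexed by the roots
[w alpha_s], and two of them satisfy a braid relation exactly when their roots
are [w alpha_s] and [w alpha_t] with [m s t] finite.  In this Artin group the
generators of opposite roots are not related (their entry is infinity), and if
[m] is connected then so is the Coxeter graph on the roots.

It remains to see that an Artin group [A] with connected Coxeter graph, in which
every [i] has some [j] with [M i j] infinite, is indecomposable.  Given such [i]
and [j], [A] is the amalgam of the subgroups generated by the letters other than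
[i] and by the letters other than [j].  If [A = H x K] and neither [H] nor [K]
lay in the amalgamated subgroup, then some [u] in [H] and [v] in [K] would have
reduced forms that start and end on opposite sides, and [u v u^-1 v^-1] would be
nontrivial.  So for each [i] one of [H], [K] avoids the letter [i].  Since
standard parabolic subgroups satisfy [A_X /\ A_Y = A_(X /\ Y)], [H] lies in
[A_U] and [K] in [A_(~U)] for some set [U] of letters, whence [U] and its
complement commute, and [U] is empty or everything.

The intersection property comes from an action of [A] on [A x D], where [D] is
the set of minimal coset representatives for [W_X]: a generator [s] moves
[(a, w)] to [(a, w s)] unless [w s w^-1] is some [x] in [X], in which case it
moves it to [(a x, w)]. *)
From HB Require Import structures.
Require Import Defs.
From mathcomp Require Import all_boot all_algebra all_field.
From mathcomp Require Import boolp classical_sets.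
From mathcomp Require Import zify ring.

Set Implicit Arguments.
Unset Strict Implicit.
Unset Printing Implicit Defensive.

Local Open Scope group_scope.

(** * Presented groups and the geometric representation *)

Section WordAction.
Variables (X : countType) (R : word X -> word X -> Prop).
Variables (Om : Type) (Dom : Om -> Prop) (act : X * bool -> Om -> Om).

Definition run (u : word X) (o : Om) : Om := foldl (fun o l => act l o) o u.

Lemma run_cat u v o : run (u ++ v) o = run v (run u o).
Proof. exact: foldl_cat. Qed.

Hypothesis act_dom : forall l o, Dom o -> Dom (act l o).
Hypothesis act_cancel :
  forall x b o, Dom o -> act (x, ~~ b) (act (x, b) o) = o.
Hypothesis act_rel : forall u v o, R u v -> Dom o -> run u o = run v o.

Lemma run_dom u o : Dom o -> Dom (run u o).
Proof. by elim: u o => //= l u IHu o Do; apply: IHu; apply: act_dom. Qed.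

Lemma run_pres_eq u v o : pres_eq R u v -> Dom o -> run u o = run v o.
Proof.
move=> uv; elim: uv o => {u v}.
- by move=> u v uv o; exact: act_rel.
- by move=> x b o Do /=; exact: act_cancel.
- move=> u u' v v' _ IHu _ IHv o Do.
  by rewrite !run_cat IHu // IHv //; exact: run_dom.
- by [].
- by move=> u v _ IH o Do; rewrite IH.
- by move=> u v w _ IHu _ IHv o Do; rewrite IHu // IHv.
Qed.

(** A right action of the letters that respects the relations separates words. [Dom] carries the
    invariant of the states, so that these can stay plain data. *)
Lemma run_wclass u v o :
  wclass R u = wclass R v -> Dom o -> run u o = run v o.
Proof. by move/wclassP; exact: run_pres_eq. Qed.
End WordAction.

Section GenSub.
Variables (X : countType) (R : word X -> word X -> Prop).

Definition gensub (Y : pred X) (g : presented R) : Prop :=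
  exists2 u : word X, all (fun l => Y l.1) u & wclass R u = g.

Lemma gensub1 Y : gensub Y 1.
Proof. by exists [::]; rewrite ?wclass_nil. Qed.

Lemma gensubM Y g h : gensub Y g -> gensub Y h -> gensub Y (g * h).
Proof.
by move=> [u Yu <-] [v Yv <-]; exists (u ++ v); rewrite ?all_cat ?Yu ?wclass_cat.
Qed.

Lemma gensubV Y g : gensub Y g -> gensub Y g^-1.
Proof.
move=> [u Yu <-]; exists (inv_word u); last by rewrite wclass_inv.
by rewrite all_rev all_map.
Qed.

Lemma gensub_gen (Y : pred X) x : Y x -> gensub Y (gen R x).
Proof. by move=> Yx; exists [:: (x, false)]; rewrite //= Yx. Qed.

Lemma gensub_sub (Y Z : pred X) g :
  (forall x, Y x -> Z x) -> gensub Y g -> gensub Z g.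
Proof.
by move=> YZ [u Yu <-]; exists u => //; apply: sub_all Yu => l; exact: YZ.
Qed.

Lemma gensubT g : gensub xpredT g.
Proof. by exists (repr g); rewrite ?wclass_repr //; apply/allP. Qed.

Lemma wclass_cons l u :
  wclass R (l :: u) = (if l.2 then (gen R l.1)^-1 else gen R l.1) * wclass R u.
Proof.
rewrite -cat1s wclass_cat; congr (_ * _).
by case: l => x [] //=; rewrite -wclass_inv.
Qed.
End GenSub.

(** * The geometric representation over the algebraic numbers *)

Section GeometricRepresentation.
Variables (S : countType) (m : coxeter_matrix S).
Local Open Scope ring_scope.
Import GRing.Theory.

(** The order is written as a successor so that a root exists for every [k]; it equals [2k] once
    [k > 0]. *)
Definition zeta (k : nat) : algC := sval (C_prim_root_exists (ltn0Sn k.*2.-1)).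

Lemma zetaP k : (0 < k)%N -> (k.*2).-primitive_root (zeta k).
Proof.
move=> k0; rewrite -{1}(@prednK k.*2) ?double_gt0 //.
exact: svalP (C_prim_root_exists (ltn0Sn k.*2.-1)).
Qed.

(** A Galois conjugate of [2 cos (pi / k)], hence a stand-in for [-2 B(alpha_s, alpha_t)] with the
    usual form [B]; an infinite entry gives [B = -1]. *)
Definition cox_coef s t : algC :=
  if m s t is Some k then zeta k + (zeta k)^-1 else 2.

Lemma cox_coef_sym s t : cox_coef s t = cox_coef t s.
Proof. by rewrite /cox_coef cox_m_sym. Qed.

(** The contragredient action: [f] lists the values of a linear form on the simple roots, and the
    reflection of [s] sends [alpha_r] to [alpha_r + cox_coef s r alpha_s]. *)
Definition refl_act (l : S * bool) (f : S -> algC) : S -> algC :=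
  fun r => if r == l.1 then - f r else f r + cox_coef l.1 r * f l.1.

Lemma refl_actK s b b' f : refl_act (s, b) (refl_act (s, b') f) = f.
Proof.
apply/funext => r; rewrite /refl_act /= eqxx; case: eqP => [->|_].
  by rewrite opprK.
by ring.
Qed.

Lemma flatten_nseqS (s t : S) k :
  pos_word (flatten (nseq k.+1 [:: s; t])) =
  [:: (s, false); (t, false)] ++ pos_word (flatten (nseq k [:: s; t])).
Proof. by []. Qed.

(* For z a primitive 2k-th root of unity, f |-> f s + z f t is an
   eigenfunctional of s t with eigenvalue z^-2, which has order k. *)
Lemma refl_act_phi s t (z : algC) f : s != t -> z != 0 ->
  cox_coef s t = z + z^-1 ->
  forall b b', let g := refl_act (t, b') (refl_act (s, b) f) in
  g s + z * g t = z^-1 ^+ 2 * (f s + z * f t).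
Proof.
move=> st z0 cst b b'; rewrite /= /refl_act /= !eqxx.
rewrite [t == s]eq_sym (negPf st) [cox_coef t s]cox_coef_sym cst.
by field.
Qed.

Lemma run_refl_phi s t (z : algC) k f : s != t -> z != 0 ->
  cox_coef s t = z + z^-1 ->
  let g := run refl_act (pos_word (flatten (nseq k [:: s; t]))) f in
  g s + z * g t = z^-1 ^+ (k.*2) * (f s + z * f t).
Proof.
move=> st z0 cst /=; elim: k f => [|k IHk] f; first by rewrite /= expr0 mul1r.
rewrite flatten_nseqS run_cat /= IHk refl_act_phi // mulrA -exprD.
by rewrite doubleS -[in RHS]addn2.
Qed.

(** The two equations make [alpha_r + x alpha_s + y alpha_t] orthogonal to [alpha_s] and [alpha_t],
    hence fixed by both reflections. *)
Lemma run_refl_inv s t r (x y : algC) k f :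
  s != t -> r != s -> r != t ->
  cox_coef s r - 2 * x + y * cox_coef s t = 0 ->
  cox_coef t r - 2 * y + x * cox_coef s t = 0 ->
  let g := run refl_act (pos_word (flatten (nseq k [:: s; t]))) f in
  g r + x * g s + y * g t = f r + x * f s + y * f t.
Proof.
move=> st rs rt e1 e2 /=; elim: k f => [//|k IHk] f.
rewrite flatten_nseqS run_cat /= IHk /refl_act /= !eqxx.
rewrite [t == s]eq_sym (negPf st) (negPf rs) (negPf rt).
rewrite [cox_coef t s]cox_coef_sym.
have -> : cox_coef s r = 2 * x - y * cox_coef s t.
  by apply/eqP; rewrite -subr_eq0 -e1; apply/eqP; ring.
have -> : cox_coef t r = 2 * y - x * cox_coef s t.
  by apply/eqP; rewrite -subr_eq0 -e2; apply/eqP; ring.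
ring.
Qed.

Lemma zeta_facts k : (2 <= k)%N -> [/\ zeta k != 0, (zeta k)^-1 != zeta k,
  zeta k ^+ k.*2 = 1 & 4 - (zeta k + (zeta k)^-1) ^+ 2 != 0].
Proof.
move=> k2; have prim := zetaP (ltnW k2).
have z1 := prim_expr_order prim.
have z0 : zeta k != 0.
  apply: contraTneq isT => z0; move/eqP: z1.
  by rewrite z0 expr0n double_eq0 -leqn0 leqNgt (ltnW k2) /= eq_sym oner_eq0.
have zz : (zeta k)^-1 != zeta k.
  apply/eqP => e; have : zeta k ^+ 2 == 1.
    by rewrite expr2 -{1}e mulVf.
  rewrite -(prim_order_dvd prim) => /dvdn_leq -/(_ isT).
  by rewrite -[X in (_ <= X)%N -> _]/(1.*2)%N leq_double leqNgt k2.
split=> //.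
have -> : 4 - (zeta k + (zeta k)^-1) ^+ 2 = - ((zeta k)^-1 - zeta k) ^+ 2.
  by field.
by rewrite oppr_eq0 expf_eq0 subr_eq0.
Qed.

(** The eigenfunctionals for [z] and [z^-1] both have eigenvalue 1 under [(s t)^k], which fixes the
    values at [s] and [t]; any other value is recovered from the fixed vector of [run_refl_inv]. *)
Lemma refl_act_rel u v f : cox_rel m u v -> run refl_act u f = run refl_act v f.
Proof.
case=> {u v} [s|s t k st mk]; first by rewrite /= refl_actK.
have k2 := cox_m_offdiag st mk.
have [z0 zz z1 z4] := zeta_facts k2.
have cst : cox_coef s t = zeta k + (zeta k)^-1 by rewrite /cox_coef mk.
have cstV : cox_coef s t = (zeta k)^-1 + (zeta k)^-1^-1 by rewrite cst invrK addrC.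
have P1 := run_refl_phi k f st z0 cst.
have zV0 : (zeta k)^-1 != 0 by rewrite invr_eq0.
have P2 := run_refl_phi k f st zV0 cstV.
rewrite /= invrK z1 mul1r in P2; rewrite /= exprVn z1 invr1 mul1r in P1.
set g := run _ _ _ in P1 P2 *.
have zV : (zeta k)^-1 - zeta k != 0 by rewrite subr_eq0.
have et : g t = f t.
  apply: (mulfI zV); rewrite !mulrBl.
  have -> : (zeta k)^-1 * g t - zeta k * g t =
    (g s + (zeta k)^-1 * g t) - (g s + zeta k * g t) by ring.
  by rewrite P1 P2; ring.
have es : g s = f s by apply: (addIr (zeta k * g t)); rewrite P1 et.
apply/funext => r /=; have [->//|rs] := eqVneq r s.
have [->//|rt] := eqVneq r t.
set c := cox_coef s t in cst.
rewrite -cst in z4.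
(* Cramer's rule for the system of [run_refl_inv]; the determinant [4 - c ^+ 2] is nonzero by
   [zeta_facts]. *)
pose x := (2 * cox_coef s r + c * cox_coef t r) / (4 - c ^+ 2).
pose y := (2 * cox_coef t r + c * cox_coef s r) / (4 - c ^+ 2).
have := @run_refl_inv s t r x y k f st rs rt.
rewrite -/c /= -/g es et => inv.
have E : g r + x * f s + y * f t = f r + x * f s + y * f t.
  by apply: inv; rewrite /x /y; field.
by apply: (addIr (x * f s + y * f t)); rewrite !addrA.
Qed.

Lemma run_refl_wclass u v f : wclass (cox_rel m) u = wclass (cox_rel m) v ->
  run refl_act u f = run refl_act v f.
Proof.
move=> uv; apply: (run_wclass (Dom := fun=> True) (R := cox_rel m)) => //.
- by move=> x b o _; rewrite refl_actK.
- by move=> ? ? ? ? _; exact: refl_act_rel.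
Qed.

(** The indicator function of [x] is fixed by every reflection but that of [x], which changes its
    value at [x] to -1. *)
Lemma cox_gen_gensub (Y : pred S) x : gensub Y (cox_gen m x) -> Y x.
Proof.
case=> u Yu e; apply: contraT => Yx.
pose f r : algC := (r == x)%:R.
have := congr1 (@^~ x) (run_refl_wclass f e) => /=.
have -> : run refl_act u f = f.
  elim: u Yu {e} => //= -[s b] u IHu /andP[/= Ys Yu].
  have -> : refl_act (s, b) f = f; last exact: IHu.
  have sx : (s == x) = false by apply: contraNF Yx => /eqP <-.
  apply/funext => r; rewrite /refl_act /f /= sx mulr0 addr0; case: eqP => // ->.
  by rewrite sx oppr0.
rewrite /refl_act /f /= eqxx => /eqP; rewrite -subr_eq0 opprK -natrD.
by rewrite Num.Theory.pnatr_eq0.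
Qed.

Lemma cox_gen_inj : injective (cox_gen m).
Proof.
move=> s t e; have: gensub (pred1 t) (cox_gen m s).
  by rewrite e; apply: gensub_gen => /=.
by move/cox_gen_gensub/eqP.
Qed.

Lemma wclass_flatten s t k :
  wclass (cox_rel m) (pos_word (flatten (nseq k [:: s; t]))) =
  ((cox_gen m s * cox_gen m t) ^+ k)%g.
Proof.
elim: k => [|k IHk]; first by rewrite wclass_nil.
by rewrite flatten_nseqS wclass_cat IHk expgS -cat1s wclass_cat.
Qed.

(** For a finite entry [n] the eigenvalue [z^-2] of [s t] has order [n]. For an infinite one, the
    powers of [s t] shift the value at [s] by linearly growing amounts. *)
Lemma cox_order s t k : s != t -> (0 < k)%N ->
  ((cox_gen m s * cox_gen m t) ^+ k)%g = 1%g ->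
  exists2 n, m s t = Some n & (n %| k)%N.
Proof.
move=> st k0; rewrite -wclass_flatten -(wclass_nil (cox_rel m)) => e.
pose f r : algC := (r == s)%:R.
have fs : f s = 1 by rewrite /f eqxx.
have ft : f t = 0 by rewrite /f eq_sym (negPf st).
have {}e := run_refl_wclass f e.
case mk : (m s t) => [n|].
  exists n => //; have n2 := cox_m_offdiag st mk.
  have [z0 _ _ _] := zeta_facts n2.
  have := @run_refl_phi s t (zeta n) k f st z0.
  rewrite {1}/cox_coef mk => /(_ erefl) /=; rewrite e /= fs ft mulr0 addr0 mulr1.
  move/esym/eqP; rewrite exprVn invr_eq1 -(prim_order_dvd (zetaP (ltnW n2))).
  by rewrite -!muln2 dvdn_pmul2r.
have cst : cox_coef s t = 2 by rewrite /cox_coef mk.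
have H j g : let h := run refl_act (pos_word (flatten (nseq j [:: s; t]))) g in
   h s + h t = g s + g t /\ h s = g s + (2 * j)%:R * (g s + g t).
  elim: j g => [|j IHj] g; first by rewrite /= mul0r addr0.
  rewrite flatten_nseqS run_cat /=.
  have [-> ->] := IHj (refl_act (t, false) (refl_act (s, false) g)).
  rewrite /refl_act /= !eqxx [t == s]eq_sym (negPf st).
  rewrite [cox_coef t s]cox_coef_sym cst.
  by split; rewrite ?mulnS ?natrD; ring.
have [_] := H k f; rewrite e /= fs ft addr0 mulr1 => /eqP.
rewrite -subr_eq0 opprD addrA subrr sub0r oppr_eq0 Num.Theory.pnatr_eq0.
by rewrite muln_eq0 /= -leqn0 leqNgt k0.
Qed.
End GeometricRepresentation.

(** * Inversions in Coxeter groups *)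

Section Alternating.
Variable G : groupType.
Implicit Types a b : G.

Fixpoint altw a b (n : nat) : G := if n is n'.+1 then a * altw b a n' else 1.

Lemma altwSr a b n : altw a b n.+1 = altw a b n * (if odd n then b else a).
Proof.
elim: n a b => [|n IHn] a b; first by rewrite /= mulg1 mul1g.
by rewrite [LHS]/= -/(altw b a n.+1) IHn mulgA /=; case: (odd n).
Qed.

Lemma altw_conj a b n : altw a b n.+1.*2.+1 = a * altw b a n.*2.+1 * a.
Proof.
by rewrite doubleS [LHS]/= -/(altw b a n.*2.+2) altwSr [odd _]/= odd_double mulgA.
Qed.

Lemma altw_double a b n : altw a b n.*2 = (a * b) ^+ n.
Proof. by elim: n => // n IHn; rewrite doubleS /= IHn expgS mulgA. Qed.
End Alternating.

Lemma eq_conjg (G : groupType) (x y z : G) : (x ^ y == z) = (x == z ^ y^-1).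
Proof. by apply/eqP/eqP => [<-|->]; rewrite ?conjgK ?conjgKV. Qed.

Lemma prod_alt (X : Type) (G : groupType) (f : X -> G) x y n :
  \prod_(z <- alt x y n) f z =
  if odd n then altw (f x) (f y) n else altw (f y) (f x) n.
Proof.
elim: n x y => [|n IHn] x y; first by rewrite big_nil.
rewrite [alt _ _ _]/= -cats1 big_cat big_seq1 IHn !altwSr /=.
by case: (odd n).
Qed.

Section Inversions.
Variables (S : countType) (m : coxeter_matrix S).
Local Notation W := (cox_group m).
Local Notation g := (cox_gen m).

Lemma cox_genV s : (g s)^-1 = g s.
Proof. by apply: (mulgI (g s)); rewrite mulgV cox_genK. Qed.

Lemma cox_wclass_cons l u :
  wclass (cox_rel m) (l :: u) = g l.1 * wclass (cox_rel m) u.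
Proof. by rewrite wclass_cons -/(g l.1) cox_genV if_same. Qed.

(** Parity of the number of prefixes [s_1 ... s_i] of [u] with [r = s_1 ... s_i ... s_1]; unlike the
    number itself, it depends only on the class of [u]. *)
Fixpoint ninv_word (u : word S) (r : W) : bool :=
  if u is l :: u' then (r == g l.1) (+) ninv_word u' (r ^ g l.1) else false.

Lemma ninv_word_cat u v r : ninv_word (u ++ v) r =
  ninv_word u r (+) ninv_word v (r ^ wclass (cox_rel m) u).
Proof.
elim: u r => [|l u IHu] r; first by rewrite /= wclass_nil conjg1.
by rewrite /= IHu cox_wclass_cons conjgM addbA.
Qed.

Fixpoint altl (s t : S) (n : nat) : seq S :=
  if n is n'.+1 then s :: altl t s n' else [::].

Lemma flatten_altl s t k : flatten (nseq k [:: s; t]) = altl s t k.*2.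
Proof. by elim: k => //= k ->. Qed.

Lemma wclass_altl s t k :
  wclass (cox_rel m) (pos_word (altl s t k)) = altw (g s) (g t) k.
Proof.
elim: k s t => [|k IHk] s t /=; first by rewrite wclass_nil.
by rewrite cox_wclass_cons IHk.
Qed.

Lemma ninv_word_altl s t k r : ninv_word (pos_word (altl s t k)) r =
  \big[addb/false]_(0 <= j < k) (r == altw (g s) (g t) j.*2.+1).
Proof.
elim: k s t r => [|k IHk] s t r; first by rewrite big_nil.
rewrite big_nat_recl //= mulg1 IHk; congr (_ (+) _); apply: eq_bigr => j _.
by rewrite eq_conjg cox_genV conjgE cox_genV mulgA -altw_conj.
Qed.

Lemma altw_period s t k j : s != t -> m s t = Some k ->
  altw (g s) (g t) (k + j).*2.+1 = altw (g s) (g t) j.*2.+1.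
Proof.
move=> st mk; have E i : altw (g s) (g t) i.*2.+1 = (g s * g t) ^+ i * g s.
  by rewrite altwSr odd_double altw_double.
by rewrite !E expgnDr (cox_gen_pow st mk) mul1g.
Qed.

(** The reflections attached to the [2k] prefixes of [(s t)^k] are the [(s t)^j s], of period [k] in
    [j], so each occurs an even number of times. *)
Lemma ninv_word_pres u v r :
  pres_eq (cox_rel m) u v -> ninv_word u r = ninv_word v r.
Proof.
move=> uv; elim: uv r => {u v}.
- move=> u v [s|s t k st mk] r /=.
    by rewrite addbF eq_conjg cox_genV conjgE mulKg addbb.
  rewrite flatten_altl ninv_word_altl -addnn (big_cat_nat (n := k)) ?leq_addr //=.
  set c := \big[_/_]_(0 <= _ < _) _; suff -> : \big[addb/false]_(k <= j < k + k)
    (r == altw (g s) (g t) j.*2.+1) = c by rewrite addbb.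
  rewrite -{1}[k]add0n big_addn addnK; apply: eq_bigr => j _.
  by rewrite addnC (altw_period _ st mk).
- by move=> s b r /=; rewrite addbF eq_conjg cox_genV conjgE mulKg addbb.
- move=> u u' v v' uu IHu _ IHv r.
  rewrite !ninv_word_cat IHu IHv (_ : wclass _ u = wclass _ u') //.
  exact/wclassP.
- by [].
- by move=> u v _ IH r; rewrite IH.
- by move=> u v w _ IHu _ IHv r; rewrite IHu.
Qed.

(* For a reflection r, ninv w r tells whether r is a left inversion of w. *)
Definition ninv (w r : W) : bool := ninv_word (repr w) r.

Lemma ninv_wclass u r : ninv (wclass (cox_rel m) u) r = ninv_word u r.
Proof. exact/ninv_word_pres/repr_wclass. Qed.

Lemma ninv1 r : ninv 1 r = false.
Proof. by rewrite -(wclass_nil (cox_rel m)) ninv_wclass. Qed.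

Lemma ninvM v w r : ninv (v * w) r = ninv v r (+) ninv w (r ^ v).
Proof.
rewrite -(wclass_repr v) -(wclass_repr w) -wclass_cat !ninv_wclass.
exact: ninv_word_cat.
Qed.

Lemma ninv_gen s r : ninv (g s) r = (r == g s).
Proof. by rewrite ninv_wclass /= addbF. Qed.

Lemma ninv_altw s t k r : ninv (altw (g s) (g t) k) r =
  \big[addb/false]_(0 <= j < k) (r == altw (g s) (g t) j.*2.+1).
Proof. by rewrite -wclass_altl ninv_wclass ninv_word_altl. Qed.

Lemma cox_gen_neq1 s : g s != 1.
Proof.
apply/eqP => e; have := ninv_gen s (g s).
by rewrite eqxx e ninv1.
Qed.

(** Strong exchange: an odd number of occurrences means at least one, and the letter of the first
    occurrence is deleted. *)
Lemma exchange u r : ninv_word u r ->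
  exists2 u', (size u' < size u)%N &
    wclass (cox_rel m) u' = r * wclass (cox_rel m) u.
Proof.
elim: u r => //= l u IHu r; have [-> _|_ /=] := eqVneq r (g l.1).
  by exists u => //; rewrite cox_wclass_cons cox_genKl.
move/IHu=> [u' lt e]; exists ((l.1, false) :: u'); first exact: lt.
by rewrite !cox_wclass_cons e conjgE cox_genV /= !mulgA cox_genK mul1g.
Qed.

(** [d] is given by a shortest word with class in the coset [w W_Y]; an inversion [d r d^-1] would
    by exchange yield a shorter word for [d r], in the same coset. *)
Lemma min_coset (Y : pred S) w : exists d v, [/\ gensub Y v, w = d * v
  & forall r, gensub Y r -> ninv d (r ^ d^-1) = false].
Proof.
pose P n := `[< exists u v,
  [/\ size u = n, gensub Y v & w = wclass (cox_rel m) u * v] >].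
have exP : exists n, P n.
  exists (size (repr w)); apply/asboolP; exists (repr w), 1.
  by split; rewrite ?mulg1 ?wclass_repr //; exact: gensub1.
case: (ex_minnP exP) => n /asboolP[u [v [su Yv wE]]] nmin.
exists (wclass (cox_rel m) u), v; split=> // r Yr.
apply: contraTF isT; rewrite ninv_wclass => /exchange[u' lt e].
have /nmin : P (size u').
  apply/asboolP; exists u', (r^-1 * v); split=> //.
    by apply: gensubM => //; exact: gensubV.
  by rewrite e wE conjgE invgK !mulgA mulgVK mulgK.
by rewrite leqNgt -su lt.
Qed.

Lemma altw_braid s t k : s != t -> m s t = Some k ->
  altw (g s) (g t) k = altw (g t) (g s) k.
Proof.
by move=> st mk; have := cox_braid st mk; rewrite !prod_alt; case: (odd k).
Qed.

(** An inversion of the prefix has the form [(s t)^j s] with [j < p]; if it were [t], then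
    [(s t)^(j+1) = 1] below the order [k]. *)
Lemma ninv_altw_other s t k p : s != t -> m s t = Some k -> (p < k)%N ->
  ninv (altw (g s) (g t) p) (g t) = false.
Proof.
move=> st mk pk; rewrite ninv_altw big_nat big1 // => j /andP[_ jp].
apply/eqP => e; have : (g s * g t) ^+ j.+1 = 1.
  rewrite -altw_double doubleS altwSr /= odd_double -/(altw (g s) (g t) j.*2.+1).
  by rewrite -e cox_genK.
move/(cox_order st) => /(_ isT)[n]; rewrite mk => -[<-] /dvdn_leq -/(_ isT).
by rewrite leqNgt (leq_ltn_trans jp pk).
Qed.

Lemma ninv_altw_self s t k p : s != t -> m s t = Some k -> (0 < p <= k)%N ->
  ninv (altw (g s) (g t) p) (g s) = true.
Proof.
move=> st mk; case: p => // p /= pk; rewrite ninvM ninv_gen eqxx conjgE mulKg.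
by rewrite (@ninv_altw_other t s k) // 1?eq_sym // cox_m_sym.
Qed.

Lemma gensub_dihedral s t k v : s != t -> m s t = Some k ->
  gensub (pred2 s t) v -> exists2 p, (p <= k)%N &
    v = altw (g s) (g t) p \/ v = altw (g t) (g s) p.
Proof.
move=> st mk [u Yu <-{v}]; elim: u Yu => [|[r c] u IHu] /=.
  by move=> _; exists 0%N; rewrite ?wclass_nil //; left.
move=> /andP[Yr /IHu[p pk e]]; rewrite cox_wclass_cons /=.
have k0 : (0 < k)%N by apply: leq_trans (cox_m_offdiag st mk).
have H s' t' q : s' != t' -> m s' t' = Some k -> (q <= k)%N ->
    exists2 p, (p <= k)%N &
    g s' * altw (g t') (g s') q = altw (g s') (g t') p \/
    g s' * altw (g t') (g s') q = altw (g t') (g s') p.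
  move=> st' mk'; rewrite leq_eqVlt => /predU1P[->|qk].
    rewrite -(altw_braid st' mk') -(prednK k0) /= cox_genKl.
    by exists k.-1; [exact: leq_pred|right].
  by exists q.+1 => //; left.
have H' s' t' q : (q <= k)%N -> exists2 p, (p <= k)%N &
    g s' * altw (g s') (g t') q = altw (g s') (g t') p \/
    g s' * altw (g s') (g t') q = altw (g t') (g s') p.
  case: q => [_|q qk]; first by exists 1%N => //; left.
  by exists q; [exact: ltnW|right; rewrite /= cox_genKl].
have ts : t != s by rewrite eq_sym.
have mk' : m t s = Some k by rewrite cox_m_sym.
case/predU1P: Yr e => [->|/eqP->] [->|->].
- exact: H'.
- exact: H.
- by have [q qk [e|e]] := H t s p ts mk' pk; exists q => //; [right|left].
- by have [q qk [e|e]] := H' t s p pk; exists q => //; [right|left].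
Qed.

Lemma altw_gensub s t p : gensub (pred2 s t) (altw (g s) (g t) p).
Proof.
elim: p s t => [|p IHp] s t; first exact: gensub1.
apply: gensubM; first by apply: gensub_gen; rewrite /= eqxx.
by apply: gensub_sub (IHp t s) => x; rewrite /= orbC.
Qed.

(* The hypothesis on d says that d is minimal in its coset d<s,t>. *)
Lemma wall_of_min_coset s t k d x v : s != t -> m s t = Some k ->
  (forall r, gensub (pred2 s t) r -> ninv d (r ^ d^-1) = false) ->
  gensub (pred2 s t) v -> g x = v ^ d^-1 -> v = g s \/ v = g t.
Proof.
move=> st mk dmin Yv e.
(* Computing the inversions of [g x * d = d * v] in both ways leaves [v] as the only inversion of
   [v] inside [<s,t>]; an alternating word inverts its first letter. *)
have nv r : gensub (pred2 s t) r -> ninv v r = (r == v).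
  move=> Yr; have := ninvM (g x) d (r ^ d^-1).
  have -> : g x * d = d * v by rewrite e conjgE invgK !mulgA mulgVK.
  rewrite ninvM dmin // -conjgM mulVg conjg1 ninv_gen e (inj_eq (@conjg_inj _ _)).
  rewrite -conjJg dmin ?addbF //; apply: gensubM; first exact: gensubV.
  exact: gensubM.
have k0 : (0 < k)%N by apply: leq_trans (cox_m_offdiag st mk).
have v1 : v != 1.
  apply: contraTneq isT => v1; move/eqP: e.
  by rewrite v1 conj1g (negPf (cox_gen_neq1 x)).
have [[|p] pk [vE|vE]] := gensub_dihedral st mk Yv; try by rewrite vE eqxx in v1.
- left; have := nv (g s); rewrite {1}vE (@ninv_altw_self s t k) //.
  by move/(_ (gensub_gen _ _))/esym/eqP <- => //; rewrite /= eqxx.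
- right; have := nv (g t); rewrite {1}vE (@ninv_altw_self t s k) 1?eq_sym //;
    last by rewrite cox_m_sym.
  by move/(_ (gensub_gen _ _))/esym/eqP <- => //; rewrite /= eqxx orbT.
Qed.
End Inversions.

(** * Parabolic subgroups of Artin groups *)

Section ArtinGroup.
Variables (I : countType) (M : coxeter_matrix I).

Inductive artin_rel : word I -> word I -> Prop :=
| artin_braid s t k of s != t & M s t = Some k :
    artin_rel (pos_word (altl s t k)) (pos_word (altl t s k)).

Definition artin_group : groupType := presented artin_rel.

Local Notation A := artin_group.
Local Notation sg := (gen artin_rel).
Local Notation W := (cox_group M).
Local Notation g := (cox_gen M).

Lemma artin_wclass_altl s t k :
  wclass artin_rel (pos_word (altl s t k)) = altw (sg s) (sg t) k.
Proof.
elim: k s t => [|k IHk] s t /=; first by rewrite wclass_nil.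
by rewrite wclass_cons /= IHk.
Qed.

Lemma artin_altw s t k : s != t -> M s t = Some k ->
  altw (sg s) (sg t) k = altw (sg t) (sg s) k.
Proof.
by move=> st mk; rewrite -!artin_wclass_altl; apply: wclass_rel; constructor.
Qed.

(** * The retraction onto a standard parabolic subgroup *)

Section Retraction.
Variable X : pred I.

(** The label is unique because [cox_gen] is injective. For a minimal representative [w], a label
    marks a step to [w s] that would leave the minimal representatives. *)
Definition wall (w : W) (s : I) : option I :=
  if pselect (exists x, X x && (g x == g s ^ w^-1)) is left e
  then Some (xchoose e) else None.

Lemma wallP w s x : wall w s = Some x <-> X x /\ g x = g s ^ w^-1.
Proof.
rewrite /wall; case: pselect => [e|ne]; split=> //.
- by case=> <-; have /andP[Xx /eqP] := xchooseP e.
- case=> Xx ex; congr Some; apply: (@cox_gen_inj _ M).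
  by have /andP[_ /eqP ->] := xchooseP e.
- by case=> Xx ex; case: ne; exists x; rewrite Xx ex eqxx.
Qed.

Lemma wall_eq w s w' s' : g s ^ w^-1 = g s' ^ w'^-1 -> wall w s = wall w' s'.
Proof.
move=> e; case E: (wall w s) => [x|].
  by have /wallP[Xx gx] := E; apply/esym/wallP; rewrite gx.
case E': (wall w' s') => [x|//]; have /wallP[Xx gx] := E'.
by rewrite -E -E'; have -> : wall w s = Some x by apply/wallP; rewrite gx.
Qed.

Lemma wall_step w s : wall (w * g s) s = wall w s.
Proof.
apply: wall_eq; rewrite invgM conjgM; congr (_ ^ _).
by rewrite conjgE mulgV mulg1 invgK.
Qed.

Definition xsg (x : I) (b : bool) : A := if b then (sg x)^-1 else sg x.

Definition retr_act (l : I * bool) (o : A * W) : A * W :=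
  if wall o.2 l.1 is Some x then (o.1 * xsg x l.2, o.2) else (o.1, o.2 * g l.1).

Definition min_in (w : W) := forall x, X x -> ninv w (g x) = false.

Lemma retr_act_min l o : min_in o.2 -> min_in (retr_act l o).2.
Proof.
case: l o => [s b] [a w] /= wmin; rewrite /retr_act /=.
case E: (wall w s) => [y|] x Xx /=; first exact: wmin.
rewrite ninvM wmin // ninv_gen /=.
apply/eqP => e; suff : wall w s = Some x by rewrite E.
by apply/wallP; rewrite -e conjgK.
Qed.

Lemma retr_actK x b o : retr_act (x, ~~ b) (retr_act (x, b) o) = o.
Proof.
case: o => a w; rewrite /retr_act /=; case E: (wall w x) => [y|] /=.
  by rewrite E -mulgA /xsg; case: b; rewrite /= ?mulgV ?mulVg mulg1.
by rewrite wall_step E -mulgA cox_genK mulg1.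
Qed.

Section Coset.
Variables (s t : I) (k : nat) (d : W).
Hypotheses (st : s != t) (mk : M s t = Some k).
Hypothesis dmin : forall r, gensub (pred2 s t) r -> ninv d (r ^ d^-1) = false.

(** By [wall_of_min_coset] the reflection of a wall, brought back to [d], is [g s] or [g t]: all
    labels in the coset come from the two walls of [d]. *)
Lemma wall_coset v r x : gensub (pred2 s t) v -> pred2 s t r ->
  wall (d * v) r = Some x ->
  (g r ^ v^-1 = g s /\ wall d s = Some x) \/
  (g r ^ v^-1 = g t /\ wall d t = Some x).
Proof.
move=> Yv Yr /wallP[Xx]; rewrite invgM conjgM => gx.
have Yrv : gensub (pred2 s t) (g r ^ v^-1).
  apply: gensubM; first by rewrite invgK.
  by apply: gensubM; [exact: gensub_gen|exact: gensubV].
have [e|e] := wall_of_min_coset st mk dmin Yrv gx; [left|right]; split=> //.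
  by apply/wallP; rewrite gx e.
by apply/wallP; rewrite gx e.
Qed.

Lemma run_no_wall p q r a v : wall d s = None -> wall d t = None ->
  gensub (pred2 s t) v -> pred2 s t q -> pred2 s t r ->
  run retr_act (pos_word (altl q r p)) (a, d * v) =
  (a, d * (v * altw (g q) (g r) p)).
Proof.
move=> ns nt; elim: p q r v => [|p IHp] q r v Yv Yq Yr; first by rewrite mulg1.
rewrite /= {2}/retr_act /=; case E: (wall _ _) => [x|].
  by have := wall_coset Yv Yq E; rewrite ns nt => -[[]|[]].
rewrite -mulgA IHp ?mulgA //; apply: gensubM => //; exact: gensub_gen.
Qed.

Lemma run_two_walls p a x y : wall d s = Some x -> wall d t = Some y ->
  run retr_act (pos_word (altl s t p)) (a, d) = (a * altw (sg x) (sg y) p, d) /\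
  run retr_act (pos_word (altl t s p)) (a, d) = (a * altw (sg y) (sg x) p, d).
Proof.
move=> ws wt; elim: p a => [|p IHp] a; first by rewrite /= mulg1.
rewrite /= {2}/retr_act {3}/retr_act /= ws wt.
by have [_ ->] := IHp (a * sg x); have [-> _] := IHp (a * sg y); rewrite !mulgA.
Qed.

(** [g x * g y] is conjugate to [g s * g t], so the two products have the same order. *)
Lemma two_walls_order x y : wall d s = Some x -> wall d t = Some y ->
  x != y /\ M x y = Some k.
Proof.
move=> /wallP[_ gx] /wallP[_ gy].
have xy : x != y.
  apply: contraNneq st => e; apply/eqP/(@cox_gen_inj _ M).
  by apply: (@conjg_inj _ d^-1); rewrite -gx -gy e.
split=> //.
have E n : (g x * g y) ^+ n = ((g s * g t) ^+ n) ^ d^-1.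
  by rewrite gx gy -conjMg -conjXg.
have k0 : (0 < k)%N by apply: leq_trans (cox_m_offdiag st mk).
have xyk : (g x * g y) ^+ k = 1 by rewrite E (cox_gen_pow st mk) conj1g.
have [n mn nk] := cox_order xy k0 xyk.
rewrite mn; congr Some; apply/eqP; rewrite eqn_dvd nk /=.
have n0 : (0 < n)%N by apply: leq_trans (cox_m_offdiag xy mn).
have stn : (g s * g t) ^+ n = 1.
  by apply/eqP; rewrite -(@conjg_eq1 _ _ d^-1) -E (cox_gen_pow xy mn).
by have [k'] := cox_order st n0 stn; rewrite mk => -[<-].
Qed.

Lemma min_in_coset v x : min_in (d * v) -> wall d s = Some x ->
  ninv v (g s) = false.
Proof.
move=> wmin /wallP[Xx gx]; have := wmin _ Xx; rewrite ninvM gx conjgKV dmin //.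
by apply: gensub_gen; rewrite /= eqxx.
Qed.

Section OneWall.
Variable x : I.
Hypotheses (ws : wall d s = Some x) (wt : wall d t = None).

(* The elements of D in the coset d<s,t> form a path pos 0, ..., pos k.-1 with a
   loop labelled x at each end; u p is the letter from pos p to pos p.+1. *)
Let u p := if odd p then s else t.
Let pos p := d * altw (g t) (g s) p.

Let uSS p : u p.+2 = u p. Proof. by rewrite /u /= negbK. Qed.

Let posS p : pos p.+1 = pos p * g (u p).
Proof. by rewrite /pos altwSr mulgA /u; case: (odd p). Qed.

Let ts : t != s. Proof. by rewrite eq_sym. Qed.
Let mk' : M t s = Some k. Proof. by rewrite cox_m_sym. Qed.

Let Yalt p : gensub (pred2 s t) (altw (g t) (g s) p).
Proof. by apply: gensub_sub (altw_gensub _ _ _ _) => y; rewrite /= orbC. Qed.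

Let k0 : (0 < k)%N. Proof. by apply: leq_trans (cox_m_offdiag st mk). Qed.

(** A wall here would make the prefix of length [p.+1] equal to [s] times the one of length [p],
    with [s] as an inversion; this is impossible below length [k]. *)
Lemma wall_up p : (p.+1 < k)%N -> wall (pos p) (u p) = None.
Proof.
move=> pk; case E: (wall _ _) => [y|//].
have Yu : pred2 s t (u p) by rewrite /u /=; case: odd; rewrite eqxx ?orbT.
have := wall_coset (Yalt p) Yu E; rewrite wt => -[[e _]|[]//].
have : ninv (altw (g t) (g s) p.+1) (g s) = true.
  have -> : altw (g t) (g s) p.+1 = g s * altw (g t) (g s) p.
    by rewrite altwSr conjgCV; congr (_ * _); rewrite -[RHS]e /u; case: odd.
  by rewrite ninvM ninv_gen eqxx conjgE mulKg (@ninv_altw_other _ _ t s k) // ltnW.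
by rewrite (@ninv_altw_other _ _ t s k).
Qed.

Lemma wall_down p : (p.+1 < k)%N -> wall (pos p.+1) (u p) = None.
Proof. by move=> pk; rewrite posS wall_step wall_up. Qed.

Lemma wall_top : wall (pos k.-1) (u k.-1) = Some x.
Proof.
rewrite -ws; apply: wall_eq; rewrite /pos invgM conjgM; congr (_ ^ _).
apply/eqP; rewrite eq_conjg invgK; apply/eqP/(mulgI (altw (g t) (g s) k.-1)).
rewrite -conjgC.
have := altw_braid st mk; rewrite -(prednK k0) [LHS]/= altwSr => ->.
by rewrite /u; case: odd.
Qed.

Lemma altl_add i j p : altl (u p) (u p.+1) (i + j) =
  altl (u p) (u p.+1) i ++ altl (u (p + i)) (u (p + i).+1) j.
Proof.
elim: i p => [|i IHi] p; first by rewrite add0n addn0.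
by rewrite addSn /= -{2 4}uSS IHi addSnnS uSS.
Qed.

Lemma run_up p j a : (p + j < k)%N ->
  run retr_act (pos_word (altl (u p) (u p.+1) j)) (a, pos p) = (a, pos (p + j)).
Proof.
elim: j p => [|j IHj] p pj; first by rewrite addn0.
rewrite /= {2}/retr_act /= wall_up; last by lia.
by rewrite -posS -[u p]uSS IHj addSnnS // -addSnnS.
Qed.

Lemma run_down p j a : (p < k)%N -> (j <= p)%N ->
  run retr_act (pos_word (altl (u p.+1) (u p) j)) (a, pos p) = (a, pos (p - j)).
Proof.
elim: j p => [|j IHj] p pk jp; first by rewrite subn0.
case: p pk jp => // p pk jp; rewrite /= {2}/retr_act /= uSS wall_down //.
by rewrite posS -mulgA cox_genK mulg1 IHj // ltnW.
Qed.

(** The word climbs [k.-1 - p] steps, goes once round the top loop and descends [p] steps. In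
    [run_full_down] it descends [p] steps, uses the bottom loop and climbs, with the same result. *)
Lemma run_full_up p a : (p < k)%N ->
  run retr_act (pos_word (altl (u p) (u p.+1) k)) (a, pos p) =
  (a * sg x, pos (k.-1 - p)).
Proof.
move=> pk; have kE : k = ((k.-1 - p) + p.+1)%N by lia.
rewrite {1}kE altl_add /pos_word map_cat run_cat run_up; last by lia.
have -> : (p + (k.-1 - p) = k.-1)%N by lia.
rewrite /= {2}/retr_act /= wall_top /= run_down //; lia.
Qed.

Lemma run_full_down p a : (p < k)%N ->
  run retr_act (pos_word (altl (u p.+1) (u p) k)) (a, pos p) =
  (a * sg x, pos (k.-1 - p)).
Proof.
move=> pk; have kE : k = (p + (k.-1 - p).+1)%N by lia.
rewrite -[u p]uSS {1}kE altl_add /pos_word map_cat run_cat uSS run_down // subnn.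
have e0 : u (p.+1 + p) = s by rewrite /u addSn addnn /= odd_double.
have e1 : u (p.+1 + p).+1 = u 0 by rewrite /u addSn addnn /= odd_double.
rewrite e0 e1 /= {2}/retr_act /= /pos /= mulg1 ws /=.
by have := @run_up 0 (k.-1 - p) (a * sg x); rewrite add0n /pos /= mulg1; apply; lia.
Qed.

Lemma run_one_wall p a : (p < k)%N ->
  run retr_act (pos_word (altl s t k)) (a, pos p) =
  run retr_act (pos_word (altl t s k)) (a, pos p).
Proof.
move=> pk; have := run_full_up a pk; have := run_full_down a pk.
by rewrite /u /=; case: odd => /= -> ->.
Qed.
End OneWall.
End Coset.

(** As [s] is not an inversion of [v], [v] is an alternating word of length below [k] starting with
    [t], or empty: a position on the path. *)
Lemma run_one_wall_case s t k d v x a : s != t -> M s t = Some k ->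
  (forall r, gensub (pred2 s t) r -> ninv d (r ^ d^-1) = false) ->
  gensub (pred2 s t) v -> min_in (d * v) ->
  wall d s = Some x -> wall d t = None ->
  run retr_act (pos_word (altl s t k)) (a, d * v) =
  run retr_act (pos_word (altl t s k)) (a, d * v).
Proof.
move=> st mk dmin Yv wmin ws wt; have nv := min_in_coset dmin wmin ws.
have [p pk [vE|vE]] := gensub_dihedral st mk Yv; last first.
  rewrite vE; apply: (run_one_wall st mk dmin ws wt).
  move: pk; rewrite leq_eqVlt => /predU1P[pk|//]; move: nv; rewrite vE pk.
  rewrite -(altw_braid st mk) (ninv_altw_self st mk) // leqnn andbT.
  by apply: leq_trans (cox_m_offdiag st mk).
case: p pk vE => [|p] pk vE; last first.
  by move: nv; rewrite vE (ninv_altw_self st mk).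
rewrite vE; apply: (@run_one_wall _ _ _ _ st mk dmin _ ws wt 0).
by apply: leq_trans (cox_m_offdiag st mk).
Qed.

(** With no wall at [d], the run stays free in the coset and the Coxeter braid relation suffices.
    With two, minimality forces [v = 1] and the labels satisfy a braid relation of [A]. With one,
    the run follows the path. *)
Lemma retr_act_rel u v o : artin_rel u v -> min_in o.2 ->
  run retr_act u o = run retr_act v o.
Proof.
case=> {u v} s t k st mk; case: o => a w /= wmin.
have [d [v [Yv wE dmin]]] := min_coset (pred2 s t) w.
have ts : t != s by rewrite eq_sym.
have mk' : M t s = Some k by rewrite cox_m_sym.
have sw r : gensub (pred2 t s) r -> gensub (R := cox_rel M) (pred2 s t) r.
  by apply: gensub_sub => z; rewrite /= orbC.
have dmin' r : gensub (pred2 t s) r -> ninv d (r ^ d^-1) = false by move/sw/dmin.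
have Yv' : gensub (pred2 t s) v by apply: gensub_sub Yv => z; rewrite /= orbC.
have k0 : (0 < k)%N by apply: leq_trans (cox_m_offdiag st mk).
rewrite wE in wmin *.
case ws: (wall d s) => [x|]; case wt: (wall d t) => [y|].
- have vE : v = 1.
    have ns := min_in_coset dmin wmin ws; have nt := min_in_coset dmin' wmin wt.
    have [[|p] pk [vE|vE]] := gensub_dihedral st mk Yv; try exact: vE.
      by rewrite vE (ninv_altw_self st mk) in ns.
    by rewrite vE (ninv_altw_self ts mk') in nt.
  have [xy mxy] := two_walls_order st mk ws wt.
  rewrite vE mulg1; have [-> ->] := run_two_walls k a ws wt.
  by rewrite (artin_altw xy mxy).
- exact: (run_one_wall_case _ st mk dmin Yv wmin ws wt).
- exact/esym/(run_one_wall_case _ ts mk' dmin' Yv' wmin wt ws).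
- rewrite !(run_no_wall st mk dmin) //= ?eqxx ?orbT //.
  by rewrite (altw_braid st mk).
Qed.

Lemma min_in1 : min_in 1.
Proof. by move=> x _; rewrite ninv1. Qed.

Lemma run_retr_sub u a : all (fun l => X l.1) u ->
  run retr_act u (a, 1) = (a * wclass artin_rel u, 1).
Proof.
elim: u a => [|[s b] u IHu] a /=; first by rewrite wclass_nil mulg1.
move=> /andP[Xs Xu]; have ws : wall 1 s = Some s.
  by apply/wallP; rewrite invg1 conjg1.
by rewrite {2}/retr_act /= ws IHu // wclass_cons -mulgA.
Qed.

(** Letters of [Y] keep [w] in [W_Y], so a label [x = w s w^-1] met on the way lies in [Y] as well
    as in [X]. *)
Lemma run_retr_inter (Y : pred I) u o : all (fun l => Y l.1) u ->
  gensub (predI X Y) o.1 -> gensub Y o.2 ->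
  gensub (predI X Y) (run retr_act u o).1.
Proof.
elim: u o => [//|[s b] u IHu] [a w] /= /andP[Ys Yu] Za Yw.
case E: (wall w s) => [x|]; apply: IHu => //; rewrite /retr_act /= E //=.
  have [Xx gx] := (wallP _ _ _).1 E; have Yx : Y x.
    apply: (@cox_gen_gensub _ M); rewrite gx.
    apply: gensubM; first by rewrite invgK.
    by apply: gensubM; [exact: gensub_gen|exact: gensubV].
  have Zx : gensub (R := artin_rel) (predI X Y) (sg x).
    by apply: gensub_gen; rewrite /= Xx.
  by apply: gensubM => //; rewrite /xsg; case: b => //; exact: gensubV.
by apply: gensubM => //; exact: gensub_gen.
Qed.

(** From [(1, 1)], a word for [h] in [X] leads to [(h, 1)], while a word in [Y] keeps the first
    component in the parabolic of the intersection. *)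
Lemma artin_parabolicI (Y : pred I) (h : A) :
  gensub X h -> gensub Y h -> gensub (predI X Y) h.
Proof.
move=> [u Xu <-] [v Yv e].
have := @run_wclass _ artin_rel _ (fun o => min_in o.2) retr_act
  retr_act_min (fun x b o _ => retr_actK x b o) retr_act_rel _ _ (1, 1) e min_in1.
rewrite (run_retr_sub _ Xu) mul1g => rE.
have := @run_retr_inter Y v (1, 1) Yv (gensub1 _ _) (gensub1 _ _).
by rewrite rE.
Qed.
End Retraction.
End ArtinGroup.

(** * Direct factors of amalgams *)

Section DirectFactorsOfAmalgams.
Variables (G : groupType) (P : bool -> G -> Prop).
Hypotheses (P1 : forall b, P b 1)
  (PM : forall b x y, P b x -> P b y -> P b (x * y))
  (PV : forall b x, P b x -> P b x^-1).

Definition only (b : bool) (x : G) : Prop := P b x /\ ~ P (~~ b) x.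

Fixpoint reduced (b : bool) (l : seq G) : Prop :=
  if l is x :: l' then only b x /\ reduced (~~ b) l' else True.

Lemma onlyV b x : only b x -> only b x^-1.
Proof. by case=> Px nP; split=> [|/PV]; [exact: PV|rewrite invgK]. Qed.

Lemma onlyMr b x y : P true y -> P false y -> only b x -> only b (x * y).
Proof.
move=> Pt Pf [Px nP]; have Py c : P c y by case: c.
split=> [|Pxy]; first exact: PM.
by apply: nP; rewrite -(mulgK y x); apply: PM => //; exact: PV.
Qed.

Lemma onlyMl b x y : P true y -> P false y -> only b x -> only b (y * x).
Proof.
move=> Pt Pf /onlyV o; rewrite -[y * x]invgK invgM; apply: onlyV.
by apply: onlyMr => //; exact: PV.
Qed.

Lemma reduced_cat b l1 l2 : reduced b l1 -> reduced (b (+) odd (size l1)) l2 ->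
  reduced b (l1 ++ l2).
Proof.
elim: l1 b => [|x l1 IH] b /=; first by rewrite addbF.
by move=> [ox r1] r2; split=> //; apply: IH => //; rewrite addNb -addbN.
Qed.

Lemma reduced_rev b l : reduced b l ->
  reduced (b (+) ~~ odd (size l)) (rev [seq x^-1 | x <- l]).
Proof.
elim: l b => [//|x l IH] b /= [ox /IH r]; rewrite rev_cons -cats1 negbK.
apply: reduced_cat; first by move: r; rewrite addNb addbN negbK.
by rewrite size_rev size_map -addbA addbb addbF /=; split=> //; exact: onlyV.
Qed.

Lemma prod_rev_inv (l : seq G) :
  \prod_(x <- rev [seq x^-1 | x <- l]) x = (\prod_(x <- l) x)^-1.
Proof.
elim: l => [|x l IH]; first by rewrite !big_nil invg1.
by rewrite /= rev_cons -cats1 big_cat big_seq1 IH big_cons invgM.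
Qed.

(** Together with [reduced_neq1], this says that [G] is the amalgam of [P true] and [P false] over
    their intersection. *)
Hypothesis gen_G : forall Q : G -> Prop, Q 1 ->
  (forall b x y, P b x -> Q y -> Q (x * y)) -> forall x, Q x.
Hypothesis reduced_neq1 :
  forall b l, reduced b l -> l <> [::] -> \prod_(x <- l) x <> 1.

(** Left multiplication by an element of one factor adds a syllable or merges with the first; a
    merged syllable that falls into the intersection is absorbed by the next one. *)
Lemma reduced_form x : (P true x /\ P false x) \/
  exists b l, [/\ reduced b l, l <> [::] & \prod_(y <- l) y = x].
Proof.
elim/gen_G: x => [|b x y Px [[Pt Pf]|[b' [l [rl l0 <-]]]]]; first by left.
  have Pxy : P b (x * y) by apply: PM => //; case: b {Px}.
  case: (pselect (P (~~ b) (x * y))) => [Pxy'|nP].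
    by left; case: b Pxy Pxy' {Px}.
  by right; exists b, [:: x * y]; rewrite big_seq1.
have nP0 c z : P c z -> P (~~ c) z -> P true z /\ P false z by case: c.
case: l rl l0 => [//|z l] /= [oz rl] _.
case: (eqVneq b' b) => [eb|nb]; last first.
  have {nb} eb : b' = ~~ b by case: b b' nb {Px oz rl} => [] [].
  subst b'; case: (pselect (P (~~ b) x)) => [Px'|nP]; right.
    have [xt xf] := nP0 _ _ Px Px'; exists (~~ b), (x * z :: l); split=> //.
      by split=> //; exact: onlyMl.
    by rewrite !big_cons mulgA.
  by exists b, [:: x, z & l]; split=> //; rewrite !big_cons.
subst b'; have Pxz : P b (x * z) by apply: PM => //; case: oz.
case: (pselect (P (~~ b) (x * z))) => [Pxz'|nP]; last first.
  by right; exists b, (x * z :: l); split=> //; rewrite !big_cons mulgA.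
have [xt xf] := nP0 _ _ Pxz Pxz'.
case: l rl => [|z' l] rl; first by left; rewrite big_seq1.
right; exists (~~ b), (x * z * z' :: l); split=> //.
  by case: rl => oy rl; split=> //; exact: onlyMl.
by rewrite !big_cons !mulgA.
Qed.

Section OddConjugate.
Variable N : G -> Prop.
Hypotheses (NV : forall x, N x -> N x^-1) (NJ : forall x y, N x -> N (x ^ y)).

(** [N] stands for a direct factor. An odd form starting on the wrong side is conjugated by [c]. An
    even one is inverted if necessary, so as to start on [true], then conjugated into a form with
    one more syllable. *)
Lemma odd_reduced_true c x : P true c -> ~ P false (c * c) ->
  N x -> ~ (P true x /\ P false x) ->
  exists l, [/\ reduced true l, odd (size l) & N (\prod_(y <- l) y)].
Proof.
move=> Pc ncc Nx nx; have oc : only true c.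
  by split=> // Pfc; apply: ncc; apply: (PM (b := false)).
have conjE (y z : G) (l : seq G) : \prod_(i <- (y * z :: l) ++ [:: y^-1]) i =
    (\prod_(i <- z :: l) i) ^ y^-1.
  by rewrite big_cat big_seq1 !big_cons /= conjgE invgK !mulgA.
have even l : l <> [::] -> reduced true l -> ~~ odd (size l) ->
    N (\prod_(y <- l) y) ->
    exists l, [/\ reduced true l, odd (size l) & N (\prod_(y <- l) y)].
  case: l => [//|z l] _ [oz rl] /= ol Nl; rewrite negbK in ol.
  (* [c] serves as [r] unless [c * z] falls into the intersection; then [c^-1] does, since otherwise
     [c * c] would lie in [P false]. *)
  have [r or orz] : exists2 r, only true r & only true (r * z).
    case: (pselect (P false (c * z))) => [Pcz|nP]; last first.
      by exists c => //; split=> //; apply: (PM (b := true)) => //; case: oz.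
    exists c^-1; first exact: onlyV.
    split; first by apply: (PM (b := true)); [exact: PV|case: oz].
    move=> Pcz'; apply: ncc; have -> : c * c = c * z * (c^-1 * z)^-1.
      by rewrite invgM invgK mulgA mulgK.
    by apply: (PM (b := false)) => //; exact: (PV (b := false)).
  exists ((r * z :: l) ++ [:: r^-1]); split.
  - by apply: reduced_cat => //=; rewrite ol; split=> //; exact: onlyV.
  - by rewrite size_cat addn1 /= ol.
  - by rewrite conjE; exact: NJ.
have [//|[b [l [rl l0 xE]]]] := reduced_form x.
rewrite -xE in Nx; case ol: (odd (size l)); case: b rl => rl.
- by exists l.
- exists ((c * 1 :: l) ++ [:: c^-1]); split.
  + apply: reduced_cat; rewrite /= ?mulg1 ?ol //.
    by split=> //; exact: onlyV.
  + by rewrite size_cat addn1 /= ol.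
  + by rewrite conjE big_cons mul1g; exact: NJ.
- by apply: (even l) => //; rewrite ol.
- apply: (even (rev [seq y^-1 | y <- l])).
  + by move/(congr1 size); rewrite size_rev size_map => /size0nil.
  + by have := reduced_rev rl; rewrite ol.
  + by rewrite size_rev size_map ol.
  + by rewrite prod_rev_inv; exact: NV.
Qed.

Lemma odd_reduced_false c d x : P true c -> ~ P false (c * c) -> only false d ->
  N x -> ~ (P true x /\ P false x) ->
  exists l, [/\ reduced false l, odd (size l) & N (\prod_(y <- l) y)].
Proof.
move=> Pc ncc od Nx nx; have [l [rl ol Nl]] := odd_reduced_true Pc ncc Nx nx.
exists ((d :: l) ++ [:: d^-1]); split.
- by apply: reduced_cat => //=; rewrite ol; split=> //; exact: onlyV.
- by rewrite size_cat addn1 /= ol.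
- have -> : \prod_(i <- (d :: l) ++ [:: d^-1]) i = (\prod_(i <- l) i) ^ d^-1.
    by rewrite big_cat big_seq1 !big_cons /= conjgE invgK mulgA.
  exact: NJ.
Qed.
End OddConjugate.

(* Conjugates of x and y with reduced forms of odd length, starting and ending
   on opposite sides, have a commutator whose reduced form is nonempty. *)
Lemma commuting_normal_edge (H K : G -> Prop) c d :
  P true c -> ~ P false (c * c) -> only false d ->
  (forall x, H x -> H x^-1) -> (forall x y, H x -> H (x ^ y)) ->
  (forall x, K x -> K x^-1) -> (forall x y, K x -> K (x ^ y)) ->
  (forall x y, H x -> K y -> commute x y) ->
  (forall x, H x -> P true x /\ P false x) \/
  (forall x, K x -> P true x /\ P false x).
Proof.
move=> Pc ncc od HV HJ KV KJ HK; apply: contrapT => nHK; apply: nHK.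
case: (pselect (forall x, H x -> P true x /\ P false x)) => [|nH]; first by left.
right=> y Ky; apply: contrapT => ny; apply: nH => x Hx; apply: contrapT => nx.
have [l [rl ol Hl]] := odd_reduced_true HV HJ Pc ncc Hx nx.
have [l' [rl' ol' Kl]] := odd_reduced_false KV KJ Pc ncc od Ky ny.
have := HK _ _ Hl Kl; rewrite /commute => e.
have rV := reduced_rev rl; have rV' := reduced_rev rl'.
rewrite ol ol' /= in rV rV'.
apply: (reduced_neq1 (b := true)
  (l := l ++ l' ++ rev [seq x^-1 | x <- l] ++ rev [seq x^-1 | x <- l'])).
- apply: reduced_cat => //; rewrite ol; apply: reduced_cat => //; rewrite ol'.
  by apply: reduced_cat => //; rewrite size_rev size_map ol.
- by case: l {rl rV e Hl} ol.
- by rewrite !big_cat !prod_rev_inv /= mulgA e mulgA mulgK mulgV.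
Qed.
End DirectFactorsOfAmalgams.

(** * Artin groups with enough infinite labels *)

Section ArtinTheory.
Variables (I : countType) (M : coxeter_matrix I).
Local Notation A := (artin_group M).
Local Notation sg := (gen (artin_rel M)).

Lemma artin_to_cox u v :
  wclass (artin_rel M) u = wclass (artin_rel M) v ->
  wclass (cox_rel M) u = wclass (cox_rel M) v.
Proof.
pose act (l : I * bool) (w : cox_group M) := w * cox_gen M l.1.
have runE u' w : run act u' w = w * wclass (cox_rel M) u'.
  elim: u' w => [|l u' IH] w /=; first by rewrite wclass_nil mulg1.
  by rewrite IH cox_wclass_cons mulgA.
move=> uv; rewrite -[LHS]mul1g -[RHS]mul1g -!runE.
apply: (run_wclass (R := artin_rel M) (Dom := fun=> True)) => //.
- by move=> x b w _; rewrite /act /= -mulgA cox_genK mulg1.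
- move=> _ _ w [s t k st mk] _; rewrite !runE !wclass_altl.
  by rewrite (altw_braid st mk).
Qed.

(** The exponent sum. Braid relations are homogeneous, so it descends to the Artin group, where it
    detects nontrivial powers of generators. *)
Definition degree (u : word I) : int :=
  (\sum_(l <- u) (if l.2 then - 1 else 1))%R.

Lemma artin_degree u v : wclass (artin_rel M) u = wclass (artin_rel M) v ->
  degree u = degree v.
Proof.
pose act (l : I * bool) (z : int) := (z + (if l.2 then - 1 else 1))%R.
have runE u' z : run act u' z = (z + degree u')%R.
  rewrite /degree; elim: u' z => [|l u' IH] z /=.
    by rewrite big_nil GRing.addr0.
  by rewrite IH big_cons GRing.addrA.
move=> uv; rewrite -[LHS]GRing.add0r -[RHS]GRing.add0r -!runE.
apply: (run_wclass (R := artin_rel M) (Dom := fun=> True)) => //.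
- by move=> x [] z _; rewrite /act /=; lia.
- move=> _ _ z [s t k st mk] _; rewrite !runE; congr (_ + _)%R.
  have degE (p q : I) n : degree (pos_word (altl p q n)) = n.
    elim: n p q => [|n IH] p q; rewrite /degree /= ?big_nil // big_cons /=.
    by have := IH q p; rewrite /degree => ->.
  by rewrite !degE.
Qed.

Lemma gensub0 (Y : pred I) (h : A) : (forall x, ~~ Y x) -> gensub Y h -> h = 1.
Proof.
move=> nY [[|l u] /= Yu <-]; first by rewrite wclass_nil.
by move: Yu; rewrite (negPf (nY _)).
Qed.

Lemma commuting_generators i j : i != j -> commute (sg i) (sg j) ->
  M i j = Some 2%N.
Proof.
move=> ij e; have : wclass (cox_rel M) [:: (i, false); (j, false)] =
    wclass (cox_rel M) [:: (j, false); (i, false)].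
  apply: artin_to_cox; rewrite -[[:: (i, _); _]]cat1s -[[:: (j, _); _]]cat1s.
  by rewrite !wclass_cat.
rewrite !cox_wclass_cons !wclass_nil !mulg1 /= => {}e.
have e2 : (cox_gen M i * cox_gen M j) ^+ 2 = 1.
  by rewrite expg2 {2}e mulgA -(mulgA (cox_gen M i)) cox_genK mulg1 cox_genK.
have [n mn n2] := cox_order ij (isT : (0 < 2)%N) e2.
rewrite mn; congr Some; apply/eqP; rewrite eqn_leq (cox_m_offdiag ij mn).
by rewrite dvdn_leq.
Qed.

(** * The amalgam along an infinite entry *)

Section InfiniteEdge.
Variables (i j : I).
Hypothesis mij : M i j = None.

Let ij : i != j.
Proof. by apply: contraPneq mij => ->; rewrite cox_m_diag. Qed.

(** No braid relation involves both [i] and [j], which makes [A] the amalgam of its subgroups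
    omitting [i] ([side true]) and [j] ([side false]). *)
Definition away (b : bool) : pred I := predC1 (if b then i else j).
Definition side (b : bool) (x : A) : Prop := gensub (away b) x.

Lemma side1 b : side b 1. Proof. exact: gensub1. Qed.
Lemma sideM b x y : side b x -> side b y -> side b (x * y).
Proof. exact: gensubM. Qed.
Lemma sideV b x : side b x -> side b x^-1.
Proof. exact: gensubV. Qed.

Definition edge (x : A) : Prop := side true x /\ side false x.

Lemma edge_side b x : side b x -> side (~~ b) x -> edge x.
Proof. by case: b. Qed.
Lemma side_edge b x : edge x -> side b x.
Proof. by case: b => -[]. Qed.
Lemma edgeM x y : edge x -> edge y -> edge (x * y).
Proof. by move=> [a b] [c d]; split; exact: sideM. Qed.
Lemma edgeV x : edge x -> edge x^-1.
Proof. by move=> [a b]; split; exact: sideV. Qed.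

(** The predicate given to [choose] depends only on the left coset of [x] modulo [edge], so one
    representative is picked per coset. *)
Definition edge_rep (x : A) : A := choose (fun y => `[< edge (x^-1 * y) >]) x.

Lemma edge_repP x : edge (x^-1 * edge_rep x).
Proof.
apply/asboolP; apply: (@chooseP _ (fun y => `[< edge (x^-1 * y) >])).
by apply/asboolP; rewrite mulVg; split; exact: side1.
Qed.

Lemma edge_repM x c : edge c -> edge_rep (x * c) = edge_rep x.
Proof.
move=> ec; rewrite /edge_rep.
have eqP' : (fun y => `[< edge ((x * c)^-1 * y) >]) =1
    (fun y => `[< edge (x^-1 * y) >]).
  move=> y; apply: asbool_equiv_eq; rewrite invgM -mulgA; split=> h.
    by rewrite -[x^-1 * y](mulVKg c); apply: edgeM.
  by apply: edgeM => //; exact: edgeV.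
rewrite (eq_choose eqP'); apply: choose_id; apply/asboolP.
  by rewrite mulKg.
by rewrite mulVg; split; exact: side1.
Qed.

(* A state (c, [:: t_1; ...; t_n]) stands for the normal form t_n ... t_1 c. *)
Fixpoint normal (b : bool) (l : seq A) : Prop :=
  if l is t :: l' then
    [/\ only side (~~ b) t, edge_rep t = t & normal (~~ b) l'] else True.

Definition state : Type := (A * seq A)%type.
Definition normal_state (o : state) : Prop :=
  edge o.1 /\ exists b, normal b o.2.

(** Merging and splitting are inverse bijections between normal states and pairs of an element of
    [side b] and a list normal for [b]. On such pairs [side b] acts by right multiplication, which
    gives [side_act]. *)
Definition merge_syllable (b : bool) (o : state) : state :=
  if o.2 is t :: l then if `[< side b t >] then (t * o.1, l) else o else o.

Definition split_syllable (b : bool) (o : state) : state :=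
  if `[< side (~~ b) o.1 >] then o
  else ((edge_rep o.1)^-1 * o.1, edge_rep o.1 :: o.2).

Lemma merge_syllableP b o : normal_state o ->
  [/\ side b (merge_syllable b o).1, normal b (merge_syllable b o).2 &
      split_syllable b (merge_syllable b o) = o].
Proof.
case: o => c [|t l] /= [ec [b' nl]].
  rewrite /split_syllable /=; split=> //; first exact: side_edge.
  by rewrite asboolT //; exact: side_edge.
case: nl => ot rt nl; rewrite /merge_syllable /=.
case: (eqVneq b' b) => [eb|nb].
  subst b'; rewrite asboolF; last by case: ot => _; rewrite negbK.
  split=> //=; first exact: side_edge.
  by rewrite /split_syllable asboolT //; exact: side_edge.
have {nb} eb : b' = ~~ b by case: b b' nb {ot nl} => [] [].
subst b'; rewrite negbK in ot nl; rewrite asboolT /=; last by case: ot.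
split=> //; first by apply: sideM; [case: ot|exact: side_edge].
rewrite /split_syllable /= asboolF; last first.
  move=> h; case: ot => _; apply; rewrite -(mulgK c t); apply: sideM => //.
  by apply: sideV; exact: side_edge.
by rewrite edge_repM // rt mulKg.
Qed.

Lemma split_syllableP b x l : side b x -> normal b l ->
  normal_state (split_syllable b (x, l)) /\
  merge_syllable b (split_syllable b (x, l)) = (x, l).
Proof.
move=> sx nl; rewrite /split_syllable /=; case: asboolP => sx'.
  split; first by split; [exact: edge_side sx sx'|exists b].
  rewrite /merge_syllable /=; case: l nl => [//|t l] [ot _ _].
  by rewrite asboolF //; case: ot => _; rewrite negbK.
have er := edge_repP x.
have xE : edge_rep x = x * (x^-1 * edge_rep x) by rewrite mulVKg.
have or : only side b (edge_rep x).
  by rewrite xE; apply: (onlyMr sideM sideV); [case: er|case: er|split].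
split.
  split=> /=; first by have := edgeV er; rewrite invgM invgK.
  exists (~~ b); split; rewrite ?negbK //.
  by rewrite {1}xE edge_repM.
rewrite /merge_syllable /= asboolT; last by case: or.
by rewrite mulVKg.
Qed.

Definition side_act (b : bool) (p : A) (o : state) : state :=
  let o' := merge_syllable b o in split_syllable b (o'.1 * p, o'.2).

Lemma side_act_normal b p o :
  side b p -> normal_state o -> normal_state (side_act b p o).
Proof.
move=> sp /(merge_syllableP b)[so no _].
by have [] := split_syllableP (sideM so sp) no.
Qed.

Lemma side_actM b p p' o : side b p -> side b p' -> normal_state o ->
  side_act b p' (side_act b p o) = side_act b (p * p') o.
Proof.
move=> sp sp' /(merge_syllableP b)[so no _]; rewrite /side_act.
have [_ ->] := split_syllableP (sideM so sp) no.
by rewrite /= mulgA.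
Qed.

Lemma side_act1 b o : normal_state o -> side_act b 1 o = o.
Proof.
move=> /(merge_syllableP b)[_ _]; rewrite /side_act mulg1.
by case: (merge_syllable b o).
Qed.

(** The result does not depend on [b]: the two side actions agree on the amalgamated subgroup, so
    they glue. *)
Lemma side_act_edge b p o : edge p -> normal_state o ->
  side_act b p o = (o.1 * p, o.2).
Proof.
move=> ep no; have [ec _] := no; have [so nl sE] := merge_syllableP b no.
rewrite /side_act; case: o no ec so nl sE => c l no /= ec so nl sE.
move: so nl sE; rewrite /merge_syllable /=.
have spl l' : split_syllable b (c * p, l') = (c * p, l').
  by rewrite /split_syllable asboolT //; apply: side_edge; exact: edgeM.
case: l no => [|t l] no; first by rewrite spl.
case: asboolP => st; last by rewrite spl.
rewrite /split_syllable /=; case: (asboolP (side (~~ b) (t * c))) => // nst.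
  move=> _ _ [_ /(congr1 size)] /= /eqP.
  by rewrite -addn1 -{1}[size l]addn0 eqn_add2l.
move=> _ _ [_ rt]; rewrite asboolF; last first.
  move=> h; apply: nst; rewrite -(mulgK p (t * c)); apply: sideM => //.
  by apply: sideV; exact: side_edge.
rewrite -mulgA edge_repM; last exact: edgeM.
have rtt : edge_rep t = t by rewrite -{2}rt edge_repM.
by rewrite rtt mulKg.
Qed.

Lemma side_xsg b s x : away b s -> side b (xsg M s x : A).
Proof.
by move=> a; rewrite /xsg; case: x; [apply: sideV|]; exact: gensub_gen.
Qed.

(** Only [i] acts through [side false]. Letters other than [i] and [j] lie in [edge], where both
    actions agree. *)
Definition letter_act (l : I * bool) (o : state) : state :=
  side_act (l.1 != i) (xsg M l.1 l.2) o.

Lemma away_neq s : away (s != i) s.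
Proof. by rewrite /away /=; case: (eqVneq s i) => [->|]. Qed.

Lemma letter_actE b l o : away b l.1 -> normal_state o ->
  letter_act l o = side_act b (xsg M l.1 l.2) o.
Proof.
move=> a no; rewrite /letter_act; have [->//|nb] := eqVneq (l.1 != i) b.
have e : edge (xsg M l.1 l.2 : A).
  have a' := away_neq l.1.
  apply: (edge_side (b := b)); apply: side_xsg => //.
  by move: a'; case: b (l.1 != i) nb {a} => [] [].
by rewrite !side_act_edge.
Qed.

Lemma letter_act_normal l o : normal_state o -> normal_state (letter_act l o).
Proof. by apply: side_act_normal; apply: side_xsg; exact: away_neq. Qed.

Lemma run_letter_act b u o : all (fun l => away b l.1) u -> normal_state o ->
  run letter_act u o = side_act b (wclass (artin_rel M) u) o.
Proof.
elim: u o => [|l u IH] o /=; first by move=> _ no; rewrite wclass_nil side_act1.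
move=> /andP[a Yu] no; rewrite IH //; last exact: letter_act_normal.
rewrite (letter_actE a no) side_actM ?wclass_cons //; first exact: side_xsg.
by exists u.
Qed.

Lemma letter_actK x b o : normal_state o ->
  letter_act (x, ~~ b) (letter_act (x, b) o) = o.
Proof.
move=> no; have a := away_neq x.
rewrite /letter_act /= side_actM //; try exact: side_xsg.
have -> : xsg M x b * xsg M x (~~ b) = 1.
  by case: b; rewrite /xsg /= ?mulVg ?mulgV.
exact: side_act1.
Qed.

(** As [M i j = None], the two letters of a relation lie on a common side, where words act through
    their class. *)
Lemma letter_act_rel u v o : artin_rel M u v -> normal_state o ->
  run letter_act u o = run letter_act v o.
Proof.
move=> uv no; have wE := wclass_rel uv; case: uv wE => s t k st mk wE.
have [b [bs bt]] : exists b, away b s /\ away b t.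
  rewrite /away /=; have [si|si] := eqVneq s i; last have [ti|ti] := eqVneq t i.
  - exists false; rewrite /= si ij; split=> //; apply: contra_eqN mk => /eqP->.
    by rewrite si mij.
  - exists false; rewrite /= ti ij; split=> //; apply: contra_eqN mk => /eqP->.
    by rewrite ti cox_m_sym mij.
  - by exists true.
have al (p q : I) n : away b p -> away b q ->
    all (fun l => away b l.1) (pos_word (altl p q n)).
  by elim: n p q => //= n IH p q ap aq; rewrite ap IH.
by rewrite !(run_letter_act (b := b)) ?wE // al.
Qed.

(** The top syllable of a state normal for [b] is not on side [b], so nothing merges and each factor
    pushes one new syllable. *)
Lemma run_reduced b l o : normal_state o -> normal b o.2 -> reduced side b l ->
  exists2 u, wclass (artin_rel M) u = \prod_(x <- l) x &
    size (run letter_act u o).2 = (size l + size o.2)%N.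
Proof.
elim: l b o => [|x l IH] b o no nl /=.
  by move=> _; exists [::]; rewrite ?big_nil ?wclass_nil.
move=> [ox rl]; have [sx nsx] := ox; have [u Yu ux] := sx.
have [ec _] := no.
have rE : run letter_act u o = split_syllable b (o.1 * x, o.2).
  rewrite (run_letter_act Yu no) ux /side_act.
  suff -> : merge_syllable b o = o by [].
  case: (o) nl => c [|t l'] //= [[_ nt] _ _].
  rewrite /merge_syllable /= asboolF //.
  by rewrite negbK in nt.
have oox : only side b (o.1 * x).
  by apply: (onlyMl sideM sideV) => //; case: ec.
have no' : normal_state (run letter_act u o).
  by apply: run_dom no => ? ?; exact: letter_act_normal.
have rE2 : (run letter_act u o).2 = edge_rep (o.1 * x) :: o.2.
  by rewrite rE /split_syllable asboolF //; case: oox.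
have nr : normal (~~ b) (run letter_act u o).2.
  rewrite rE2 /= negbK; have er := edge_repP (o.1 * x).
  have xE : edge_rep (o.1 * x) =
      (o.1 * x) * ((o.1 * x)^-1 * edge_rep (o.1 * x)).
    by rewrite mulVKg.
  split=> //; last by rewrite {1}xE edge_repM.
  by rewrite xE; apply: (onlyMr sideM sideV) => //; case: er.
have [u' u'E sz] := IH _ _ no' nr rl.
exists (u ++ u'); first by rewrite wclass_cat ux u'E big_cons.
by rewrite run_cat sz rE2 /= addnS.
Qed.

Lemma reduced_side_neq1 b l :
  reduced side b l -> l <> [::] -> \prod_(x <- l) x <> 1.
Proof.
move=> rl l0 e; pose o : state := (1, [::]).
have no : normal_state o by split; [split; exact: side1|exists b].
have nb : normal b o.2 by [].
have [u uE sz] := run_reduced no nb rl.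
have := @run_wclass _ (artin_rel M) _ normal_state letter_act letter_act_normal
  letter_actK letter_act_rel u [::] o.
rewrite uE e wclass_nil => /(_ erefl no) rE; move: sz; rewrite rE /= addn0.
by move/esym/size0nil.
Qed.

Lemma side_gen (Q : A -> Prop) : Q 1 ->
  (forall b x y, side b x -> Q y -> Q (x * y)) -> forall x, Q x.
Proof.
move=> Q1 QM x; rewrite -(wclass_repr x); elim: (repr x) => [|l u IH] //.
by rewrite wclass_cons; apply: QM IH; apply: side_xsg; exact: away_neq.
Qed.

Lemma gen_side_disjoint b (x : A) :
  gensub (predC (away b)) x -> side b x -> x = 1.
Proof.
move=> sx sbx; have := artin_parabolicI sx sbx.
by apply: gensub0 => y /=; rewrite andNb.
Qed.

(** Direct factors are normal and centralise each other, so [commuting_normal_edge] applies with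
    [c = sg j] and [d = sg i]; their exponent sums keep [sg j * sg j] and [sg i] out of the wrong
    sides. *)
Lemma direct_factor_side (H K : set A) :
  is_subgroup H -> is_subgroup K -> internal_direct_product H K ->
  (forall x, H x -> side true x) \/ (forall x, K x -> side true x).
Proof.
move=> [H1 HM HV] [K1 KM KV] [_ HK gHK].
have HJ x y : H x -> H (x ^ y).
  move=> Hx; have [h [k [Hh Kk ->]]] := gHK y.
  rewrite conjgM; have Hxh : H (x ^ h) by exact: HM (HV _ Hh) (HM _ _ Hx Hh).
  by have /commgP/conjg_fixP -> := HK _ _ Hxh Kk.
have KJ x y : K x -> K (x ^ y).
  move=> Kx; have [h [k [Hh Kk ->]]] := gHK y.
  rewrite conjgM; have /commute_sym/commgP/conjg_fixP -> := HK _ _ Hh Kx.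
  exact: KM (KV _ Kk) (KM _ _ Kx Kk).
have aj : side true (sg j) by apply: gensub_gen; rewrite /away /= eq_sym.
have ai : side false (sg i) by exact: gensub_gen.
have gj : gensub (R := artin_rel M) (predC (away false)) (sg j).
  by apply: gensub_gen; rewrite /away /= eqxx.
have njj : ~ side false (sg j * sg j).
  move/(gen_side_disjoint (gensubM gj gj)).
  rewrite -wclass_cat -(wclass_nil (artin_rel M)).
  by move/artin_degree; rewrite /degree !big_cons !big_nil.
have oi : only side false (sg i).
  split=> // sti.
  have gi : gensub (R := artin_rel M) (predC (away true)) (sg i).
    by apply: gensub_gen; rewrite /away /= eqxx.
  have := gen_side_disjoint gi sti; rewrite -(wclass_nil (artin_rel M)).
  by move/artin_degree; rewrite /degree !big_cons !big_nil.
by have [h|h] := commuting_normal_edge side1 sideM sideV side_gen reduced_side_neq1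
  aj njj oi HV HJ KV KJ HK; [left|right] => x /h[].
Qed.
End InfiniteEdge.

(** There may be infinitely many letters, but a word for [h] uses finitely many; those outside [Y]
    are removed one at a time by [artin_parabolicI]. *)
Lemma gensub_of_predC1 (h : A) (Y : pred I) :
  (forall i, ~~ Y i -> gensub (predC1 i) h) -> gensub Y h.
Proof.
move=> Yh; have [u _ uE] := gensubT h.
pose s0 := [seq l.1 | l <- u].
have K (s : seq I) : gensub (fun x => (x \in s0) && ((x \in s) ==> Y x)) h.
  elim: s => [|x s IH].
    exists u => //; apply/allP => l lu; rewrite /= andbT.
    exact: map_f.
  case Yx: (Y x).
    apply: gensub_sub IH => y /andP[-> ys]; rewrite inE.
    by have [->|_] := eqVneq y x; rewrite ?Yx ?implybT.
  have := artin_parabolicI IH (Yh x (negbT Yx)).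
  apply: gensub_sub => y /=; rewrite inE => /andP[/andP[-> ys] /negPf ->].
  exact: ys.
by apply: gensub_sub (K s0) => x /andP[->].
Qed.

Theorem artin_indecomposable :
  (forall i, exists j, M i j = None) ->
  (forall U : pred I, (forall i j, U i -> ~~ U j -> M i j = Some 2%N) ->
    (forall i, U i) \/ (forall i, ~~ U i)) ->
  indecomposable A.
Proof.
move=> partner conn [H [K [sH sK HT KT dHK]]].
have [H1 HM HV] := sH; have [K1 KM KV] := sK; have [_ HKc gHK] := dHK.
(* The letters that [H] does not avoid; by [direct_factor_side] they are avoided by [K]. *)
pose U i := ~~ `[< forall x, H x -> gensub (predC1 i) x >].
have HU x : H x -> gensub U x.
  move=> Hx; apply: gensub_of_predC1 => i; rewrite negbK => /asboolP; exact.
have KU x : K x -> gensub (predC U) x.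
  move=> Kx; apply: gensub_of_predC1 => i; rewrite /= negbK => /asboolP nHi.
  have [j mij] := partner i.
  by have [//|] := direct_factor_side mij sH sK dHK; apply.
have disj (x : A) : gensub U x -> gensub (predC U) x -> x = 1.
  move=> Ux nUx; have := artin_parabolicI Ux nUx.
  by apply: gensub0 => y /=; rewrite andbN.
(* [k = h^-1 * sg i] lies in the parabolics of [U] and of its complement, hence is trivial. *)
have UH i : U i -> H (sg i).
  move=> Ui; have [h [k [Hh Kk e]]] := gHK (sg i).
  suff k1 : k = 1 by rewrite e k1 mulg1.
  apply: disj; last exact: KU.
  rewrite -(mulKg h k) -e; apply: gensubM; last exact: gensub_gen.
  by apply: gensubV; exact: HU.
have UK i : ~~ U i -> K (sg i).
  move=> Ui; have [h [k [Hh Kk e]]] := gHK (sg i).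
  suff h1 : h = 1 by rewrite e h1 mul1g.
  apply: disj; first exact: HU.
  rewrite -(mulgK k h) -e; apply: gensubM; first exact: gensub_gen.
  by apply: gensubV; exact: KU.
have full (N : set A) : is_subgroup N -> (forall i, N (sg i)) -> N = setT.
  move=> [N1 NM NV] Ng; apply/predeqP => x; split=> // _.
  rewrite -(wclass_repr x); elim: (repr x) => [|[i b] u IH] //.
  by rewrite wclass_cons; apply: NM IH; case: b => /=; [apply: NV|]; exact: Ng.
have [i j Ui Uj||] := conn U.
- apply: commuting_generators.
    by apply: contraNneq Uj => <-.
  by apply: HKc; [exact: UH|exact: UK].
- by move=> aU; apply: HT; apply: full => // i; exact: UH.
- by move=> aU; apply: KT; apply: full => // i; exact: UK.
Qed.
End ArtinTheory.

(** * The kernel of a virtual Artin group *)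

(** Roots will be encoded by elements of presented groups and must form a countable type to index an
    Artin group. *)
HB.instance Definition _ (X : countType) (R : word X -> word X -> Prop) :=
  Countable.copy (presented R) (can_type (@wclass_repr X R)).

Lemma altw_conjg (G : groupType) (a b c : G) n :
  altw a b n ^ c = altw (a ^ c) (b ^ c) n.
Proof. by elim: n a b => [|n IH] a b /=; rewrite ?conj1g // conjMg IH. Qed.

(** With a braid relation this gives back [(a b)^k = 1], as needed to map the Coxeter group to
    [VA]. *)
Lemma altw_invol_shift (G : groupType) (a b : G) k : a * a = 1 -> b * b = 1 ->
  (a * b) ^+ k * altw b a k = altw a b k.
Proof.
elim: k a b => [|k IH] a b aa bb; first by rewrite mulg1.
have -> : (a * b) ^+ k.+1 = a * (b * a) ^+ k * b.
  rewrite -!altw_double doubleS [LHS]/= -/(altw b a k.*2.+1) altwSr.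
  by rewrite odd_double mulgA.
by rewrite /= -!mulgA (mulgA b b) bb mul1g IH.
Qed.

Lemma prod_altl (X : countType) (G : groupType) (f : X -> G) x y n :
  \prod_(z <- altl x y n) f z = altw (f x) (f y) n.
Proof. by elim: n x y => [|n IH] x y; rewrite ?big_nil //= big_cons IH. Qed.

Lemma map_alt (X Y : Type) (f : X -> Y) x y n :
  alt (f x) (f y) n = [seq f z | z <- alt x y n].
Proof. by elim: n x y => //= n IH x y; rewrite IH map_rcons. Qed.

Lemma indecomposable_iso (G G' : groupType) (f : G -> G') :
  {morph f : x y / x * y} -> injective f -> (forall y, exists x, f x = y) ->
  indecomposable G -> indecomposable G'.
Proof.
move=> fM finj fsurj iG [H [K [sH sK HT KT [HK0 HKc gHK]]]]; apply: iG.
have f1 : f 1 = 1 by apply: (mulgI (f 1)); rewrite -fM !mulg1.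
have fV x : f x^-1 = (f x)^-1 by apply: (mulgI (f x)); rewrite -fM !mulgV.
have sub (N : set G') : is_subgroup N -> is_subgroup (fun x => N (f x)).
  move=> [N1 NM NV]; split; first by rewrite f1.
    by move=> x y Nx Ny; rewrite fM; exact: NM.
  by move=> x Nx; rewrite fV; exact: NV.
have proper (N : set G') : N <> setT -> (fun x => N (f x)) <> setT :> set G.
  move=> NT e; apply: NT; apply/predeqP => y; split=> // _.
  have [x <-] := fsurj y.
  by have := congr1 (fun P : set G => P x) e => /= ->.
exists (fun x => H (f x)), (fun x => K (f x)).
split; [exact: sub|exact: sub|exact: proper|exact: proper|split].
- apply/predeqP => x; split=> [[Hx Kx]|->].
    have : (H `&` K)%classic (f x) by split.
    by rewrite HK0 => /= fx; apply: finj; rewrite f1.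
  have : (H `&` K)%classic 1 by rewrite HK0.
  by case=> H1 K1; split; rewrite f1.
- by move=> x y Hx Ky; apply: finj; rewrite !fM; exact: HKc.
- move=> x; have [h [k [Hh Kk e]]] := gHK (f x).
  have [x' fx'] := fsurj h; have [y' fy'] := fsurj k.
  exists x', y'; rewrite fx' fy'; split=> //.
  by apply: finj; rewrite fM fx' fy'.
Qed.

Section KernelPresentation.
Variables (S : countType) (m : coxeter_matrix S).
Local Notation W := (cox_group m).
Local Notation g := (cox_gen m).
Local Notation V := (VA m).
Local Notation sigma s := (gen (va_rel m) (va_sigma s)).
Local Notation tau s := (gen (va_rel m) (va_tau s)).

Lemma tauK s : tau s * tau s = 1 :> V.
Proof.
have := wclass_rel (va_rel2_sq m s).
by rewrite wclass_pos !big_cons big_nil mulg1 wclass_nil.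
Qed.

Lemma sigma_altw s t k : s != t -> m s t = Some k ->
  altw (sigma s) (sigma t) k = altw (sigma t) (sigma s) k :> V.
Proof.
move=> st mk; have := wclass_rel (va_rel1 st mk).
by rewrite !wclass_pos !prod_alt; case: odd.
Qed.

Lemma tau_altw s t k : s != t -> m s t = Some k ->
  altw (tau s) (tau t) k = altw (tau t) (tau s) k :> V.
Proof.
move=> st mk; have := wclass_rel (va_rel2 st mk).
by rewrite !wclass_pos !prod_alt; case: odd.
Qed.

Lemma tau_cox_rel u v : cox_rel m u v ->
  word_eval (fun s => tau s : V) u = word_eval (fun s => tau s : V) v.
Proof.
case=> {u v} [s|s t k st mk]; rewrite word_eval_pos [RHS]/word_eval big_nil.
  by rewrite !big_cons big_nil mulg1 tauK.
rewrite flatten_altl prod_altl altw_double.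
apply: (mulIg (altw (tau t) (tau s) k)).
by rewrite altw_invol_shift ?tauK // mul1g tau_altw.
Qed.

(** A section of [piK]; it splits [VA] as a semidirect product of [KVA] and [W]. *)
Definition iota : W -> V := pres_lift tau_cox_rel.

Lemma iota_gen s : iota (g s) = tau s. Proof. exact: pres_lift_gen. Qed.
Lemma iotaM : {morph iota : x y / x * y}. Proof. exact: pres_liftM. Qed.
Lemma iota1 : iota 1 = 1. Proof. exact: pres_lift1. Qed.
Lemma iotaV w : iota w^-1 = (iota w)^-1.
Proof. by apply: (mulgI (iota w)); rewrite -iotaM !mulgV iota1. Qed.

Lemma piKM : {morph @piK S m : x y / x * y}. Proof. exact: pres_liftM. Qed.
Lemma piK1 : @piK S m 1 = 1. Proof. exact: pres_lift1. Qed.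
Lemma piKV x : @piK S m x^-1 = (piK x)^-1.
Proof. by apply: (mulgI (piK x)); rewrite -piKM !mulgV piK1. Qed.

Lemma piK_iota w : piK (iota w) = w.
Proof.
rewrite -(wclass_repr w); elim: (repr w) => [|l u IH].
  by rewrite wclass_nil iota1 piK1.
by rewrite cox_wclass_cons iotaM piKM IH iota_gen piK_tau.
Qed.

(** [P] maps [alpha_t] to [alpha_r]: the reflections match, and [r] not being an inversion of [P]
    gives the sign. By (VA3) the generators [sigma] follow, so conjugates depend only on roots. *)
Lemma va3_iota s t k : s != t -> m s t = Some k ->
  let P := \prod_(x <- alt s t k.-1) g x in let r := if odd k then s else t in
  [/\ sigma t ^ (iota P)^-1 = sigma r, g t ^ P^-1 = g r & ninv P (g r) = false].
Proof.
move=> st mk P r; have k0 : (0 < k)%N by apply: leq_trans (cox_m_offdiag st mk).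
have ts : t != s by rewrite eq_sym.
have mk' : m t s = Some k by rewrite cox_m_sym.
have iP : iota P = \prod_(x <- alt (va_tau s) (va_tau t) k.-1) gen (va_rel m) x.
  rewrite map_alt big_map /P; elim: (alt s t k.-1) => [|x l IH].
    by rewrite !big_nil iota1.
  by rewrite !big_cons iotaM IH iota_gen.
split.
- apply/eqP; rewrite eq_conjg invgK; apply/eqP/(mulgI (iota P)); rewrite -conjgC.
  have := wclass_rel (va_rel3 st mk); rewrite !wclass_pos -cats1 big_cat big_seq1.
  by rewrite big_cons -iP /= => ->; rewrite /r; case: odd.
- apply/eqP; rewrite eq_conjg invgK; apply/eqP/(mulgI P); rewrite -conjgC.
  rewrite /P prod_alt /r; case: k k0 mk mk' {P r iP} => // k _ mk mk' /=.
  case ok: (odd k) => /=.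
    by have := altw_braid st mk; rewrite altwSr ok => -> .
  by have := altw_braid st mk; rewrite [RHS]altwSr ok => <-.
- rewrite /P prod_alt /r; case: k k0 mk mk' {P r iP} => // k _ mk mk' /=.
  case: (odd k) => /=.
    by rewrite (ninv_altw_other st mk).
  by rewrite (ninv_altw_other ts mk').
Qed.

(* The root w alpha_s is encoded by its generator of the kernel, its reflection
   and its sign.  The last two determine the root; recording the generator as
   well makes it a function of the root without any proof. *)
Definition root_data (w : W) (s : S) :
    presented (va_rel m) * (presented (cox_rel m) * bool) :=
  (sigma s ^ (iota w)^-1, (g s ^ w^-1, ninv w (g s ^ w^-1))).

Definition is_root :
    pred (presented (va_rel m) * (presented (cox_rel m) * bool)) :=
  fun p => `[< exists w s, p = root_data w s >].

Definition cox_root : countType := {p | is_root p}.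

Fact is_root_data w s : is_root (root_data w s).
Proof. by apply/asboolP; exists w, s. Qed.

Definition mkroot w s : cox_root := exist _ (root_data w s) (is_root_data w s).

Lemma rootP (b : cox_root) : exists w s, b = mkroot w s.
Proof.
by case: b => p pr; have /asboolP[w [s e]] := pr; exists w, s; apply: val_inj.
Qed.

Definition reflection (b : cox_root) : W := (val b).2.1.

Lemma reflection_mkroot w s : reflection (mkroot w s) = g s ^ w^-1.
Proof. by []. Qed.

Lemma reflection_inj w s t :
  reflection (mkroot w s) = reflection (mkroot w t) -> s = t.
Proof. by rewrite !reflection_mkroot => /conjg_inj/cox_gen_inj. Qed.

Lemma mkroot_va3 w s t k : s != t -> m s t = Some k ->
  mkroot (w * \prod_(x <- alt s t k.-1) g x) t =
  mkroot w (if odd k then s else t).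
Proof.
move=> st mk; have [e1 e2 e3] := va3_iota st mk.
apply: val_inj; rewrite /= /root_data iotaM !invgM !conjgM e1 e2.
by rewrite ninvM conjgKV e3 addbF.
Qed.

Definition adjacent (b c : cox_root) (k : nat) : Prop :=
  exists w s t, [/\ b = mkroot w s, c = mkroot w t & m s t = Some k].

(** Recovers [k] from the two roots alone, whatever [w], [s] and [t], as the order of the product of
    their reflections. *)
Lemma adjacent_pow b c k : b != c -> adjacent b c k ->
  (2 <= k)%N /\ forall n, (0 < n)%N ->
    (reflection b * reflection c) ^+ n = 1 <-> (k %| n)%N.
Proof.
move=> bc [w [s [t [eb ec mk]]]].
have st : s != t by apply: contraNneq bc => st; rewrite eb ec st.
split=> [|n n0]; first exact: cox_m_offdiag st mk.
have -> : (reflection b * reflection c) ^+ n = ((g s * g t) ^+ n) ^ w^-1.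
  by rewrite eb ec !reflection_mkroot -conjMg conjXg.
split=> [/eqP|/dvdnP[q ->]]; last first.
  by rewrite mulnC expgnA (cox_gen_pow st mk) expg1n conj1g.
rewrite conjg_eq1 => /eqP /(cox_order st n0)[k'].
by rewrite mk => -[<-].
Qed.

Lemma adjacent_fun b c k k' : adjacent b c k -> adjacent b c k' -> k = k'.
Proof.
have [<-{c}|bc] := eqVneq b c.
  suff H j : adjacent b b j -> j = 1%N by move=> /H-> /H->.
  case=> w [s [t [-> /(congr1 reflection)/reflection_inj-> ]]].
  by rewrite cox_m_diag => -[].
move=> /(adjacent_pow bc)[k2 dk] /(adjacent_pow bc)[k2' dk'].
apply/eqP; rewrite eqn_dvd; apply/andP; split.
  by apply/dk; [exact: ltnW|apply/dk' => //; exact: ltnW].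
by apply/dk'; [exact: ltnW|apply/dk => //; exact: ltnW].
Qed.

Definition root_entry (b c : cox_root) : option nat :=
  if pselect (exists k, adjacent b c k) is left e
  then Some (sval (cid e)) else None.

Lemma root_entryP b c k : root_entry b c = Some k <-> adjacent b c k.
Proof.
rewrite /root_entry; case: pselect => [e|ne]; split=> //.
- by case=> <-; exact: svalP (cid e).
- by move=> a; congr Some; apply: adjacent_fun a; exact: svalP (cid e).
- by move=> a; case: ne; exists k.
Qed.

Fact root_entry_sym b c : root_entry b c = root_entry c b.
Proof.
have H b' c' k : root_entry b' c' = Some k -> root_entry c' b' = Some k.
  move=> /root_entryP[w [s [t [-> -> mk]]]]; apply/root_entryP.
  by exists w, t, s; rewrite cox_m_sym.
case E: (root_entry b c) => [k|]; first by rewrite (H _ _ _ E).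
by case E': (root_entry c b) => [k|//]; rewrite (H _ _ _ E') in E.
Qed.

Fact root_entry_diag b : root_entry b b = Some 1%N.
Proof.
apply/root_entryP; have [w [s ->]] := rootP b.
by exists w, s, s; rewrite cox_m_diag.
Qed.

Fact root_entry_offdiag b c k : b != c -> root_entry b c = Some k -> (2 <= k)%N.
Proof. by move=> bc /root_entryP/(adjacent_pow bc)[]. Qed.

Definition root_matrix : coxeter_matrix cox_root :=
  CoxeterMatrix root_entry_sym root_entry_diag root_entry_offdiag.

(** Opposite roots share their reflection. An entry would write them as [w' alpha_s'] and
    [w' alpha_t'], forcing [s' = t'] and so equating roots of opposite signs. *)
Lemma root_opp w s : root_entry (mkroot w s) (mkroot (w * g s) s) = None.
Proof.
case E: (root_entry _ _) => [k|//].
have e : g s ^ (w * g s)^-1 = g s ^ w^-1.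
  by rewrite invgM conjgM; congr (_ ^ _); rewrite conjgE mulgV mulg1 invgK.
have /root_entryP[w' [s' [t' [e1 e2 _]]]] := E.
have st : s' = t'.
  by apply: (@reflection_inj w'); rewrite -e1 -e2 !reflection_mkroot e.
have : mkroot w s = mkroot (w * g s) s by rewrite e1 e2 st.
move/(congr1 (fun b : cox_root => (val b).2.2)) => /=.
by rewrite e ninvM conjgKV ninv_gen eqxx addbT; case: ninv.
Qed.

Lemma root_partner b : exists c, root_matrix b c = None.
Proof.
by have [w [s ->]] := rootP b; exists (mkroot (w * g s) s); exact: root_opp.
Qed.

Lemma root_edge w s t : cox_edge m s t ->
  root_entry (mkroot w s) (mkroot w t) != Some 2%N.
Proof.
move=> /andP[st e]; apply/eqP => /root_entryP a.
have bc : mkroot w s != mkroot w t.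
  by apply: contraNneq st => /(congr1 reflection)/reflection_inj ->.
have [_ /(_ 2%N isT)[_ /(_ (dvdnn 2))]] := adjacent_pow bc a.
rewrite !reflection_mkroot -conjMg -conjXg => /eqP; rewrite conjg_eq1 => /eqP.
move/(cox_order st) => /(_ isT)[n mn n2]; rewrite mn in e.
by move/dvdn_leq: n2 => /(_ isT); rewrite leqNgt e.
Qed.

(** For fixed [w] the roots [w alpha_s] are linked along paths in the graph of [m]. The infinite
    entry between [w alpha_l] and its opposite [w l alpha_l] links [w] to [w l]. *)
Lemma root_connected (U : pred cox_root) : cox_connected m ->
  (forall b c, U b -> ~~ U c -> root_matrix b c = Some 2%N) ->
  (forall b, U b) \/ (forall b, ~~ U b).
Proof.
move=> conn U2.
have Ueq b c : root_entry b c != Some 2%N -> U b = U c.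
  move=> n2; case Ub: (U b); case Uc: (U c) => //.
    by rewrite (U2 b c Ub (negbT Uc) : root_entry b c = _) eqxx in n2.
  rewrite root_entry_sym in n2.
  by rewrite (U2 c b Uc (negbT Ub) : root_entry c b = _) eqxx in n2.
have Ust w s t : U (mkroot w s) = U (mkroot w t).
  have [p sp <-] := conn s t; elim: p s sp => //= r p IH s /andP[sr rp].
  by rewrite -(IH r rp); apply: Ueq; exact: root_edge.
have Uw u w s : U (mkroot (w * wclass (cox_rel m) u) s) = U (mkroot w s).
  elim: u w => [|l u IH] w; first by rewrite wclass_nil mulg1.
  rewrite cox_wclass_cons mulgA IH (Ust _ s l.1) (Ust _ s l.1).
  by apply/esym/Ueq; rewrite root_opp.
have Uall b c : U b = U c.
  have [w [s ->]] := rootP b; have [w' [s' ->]] := rootP c.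
  rewrite -(mul1g w) -(mul1g w') -(wclass_repr w) -(wclass_repr w') !Uw.
  exact: Ust.
case: (pselect (exists b, U b)) => [[b Ub]|nU]; [left|right] => c.
  by rewrite (Uall c b).
by apply/negP => Uc; apply: nU; exists c.
Qed.

(** * The isomorphism from the Artin group on the roots to the kernel *)

Local Notation A := (artin_group root_matrix).
Local Notation dl b := (gen (artin_rel root_matrix) b).

Lemma theta_rel u v : artin_rel root_matrix u v ->
  word_eval (fun b : cox_root => (val b).1 : V) u =
  word_eval (fun b : cox_root => (val b).1 : V) v.
Proof.
case=> {u v} b c k bc /root_entryP[w [s [t [eb ec mk]]]].
have st : s != t by apply: contraNneq bc => st; rewrite eb ec st.
rewrite !word_eval_pos !prod_altl eb ec /= -!altw_conjg.
by rewrite (sigma_altw st mk).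
Qed.

Definition theta : A -> V := pres_lift theta_rel.

Lemma thetaM : {morph theta : x y / x * y}. Proof. exact: pres_liftM. Qed.
Lemma theta1 : theta 1 = 1. Proof. exact: pres_lift1. Qed.
Lemma thetaV x : theta x^-1 = (theta x)^-1.
Proof. by apply: (mulgI (theta x)); rewrite -thetaM !mulgV theta1. Qed.
Lemma theta_mkroot w s : theta (dl (mkroot w s)) = sigma s ^ (iota w)^-1.
Proof. exact: pres_lift_gen. Qed.

Lemma artin_ind (Q : A -> Prop) : Q 1 ->
  (forall w s b x, Q x ->
    Q ((if b then (dl (mkroot w s))^-1 else dl (mkroot w s)) * x)) ->
  forall x, Q x.
Proof.
move=> Q1 QM x; rewrite -(wclass_repr x); elim: (repr x) => [|[c b] u IH] //.
by rewrite wclass_cons; have [w [s ->]] := rootP c; exact: QM.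
Qed.

Lemma piK_theta x : piK (theta x) = 1.
Proof.
elim/artin_ind: x => [|w s b x IH]; first by rewrite theta1 piK1.
have e : piK (theta (dl (mkroot w s))) = 1.
  by rewrite theta_mkroot !piKM piK_sigma mul1g -piKM mulVg piK1.
by rewrite thetaM piKM IH mulg1; case: b; rewrite ?thetaV ?piKV e ?invg1.
Qed.

(** Reading a word from left to right, [tau s] changes [w] to [w s] and [sigma s] multiplies [a] by
    the generator of [w alpha_s]. *)
Lemma theta_iota_surj (x : V) : exists a w, x = theta a * iota w.
Proof.
suff H u a w : exists a' w',
    theta a * iota w * wclass (va_rel m) u = theta a' * iota w'.
  have [a [w e]] := H (repr x) 1 1.
  by exists a, w; rewrite -e wclass_repr theta1 iota1 !mul1g.
elim: u a w => [|[l b] u IH] a w.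
  by exists a, w; rewrite wclass_nil mulg1.
rewrite wclass_cons mulgA; case: l => s /=.
  have -> : theta a * iota w * (if b then (sigma s)^-1 else sigma s) =
      theta (a * if b then (dl (mkroot w s))^-1 else dl (mkroot w s)) * iota w.
    rewrite thetaM -!mulgA; congr (_ * _).
    by case: b; rewrite ?thetaV theta_mkroot -?conjVg conjgE invgK !mulgA mulgVK.
  exact: IH.
have -> : (if b then (tau s)^-1 else tau s) = iota (g s).
  by case: b; rewrite iota_gen // -iota_gen -iotaV cox_genV.
by rewrite -(mulgA (theta a)) -iotaM; exact: IH.
Qed.

(** Right multiplication in the semidirect product of [A] and [W], written on pairs to avoid
    building that group. *)
Definition va_act (l : va_letter S * bool) (o : A * W) : A * W :=
  match l.1 with
  | inl s => (o.1 * xsg root_matrix (mkroot o.2 s) l.2, o.2)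
  | inr s => (o.1, o.2 * g s)
  end.

Lemma va_actK x b o : va_act (x, ~~ b) (va_act (x, b) o) = o.
Proof.
case: o x => a w [] s; rewrite /va_act /= -mulgA ?cox_genK ?mulg1 //.
by case: b; rewrite /xsg /= ?mulgV ?mulVg mulg1.
Qed.

Lemma run_sigma l a w :
  run va_act (pos_word [seq va_sigma s | s <- l]) (a, w) =
  (a * \prod_(s <- l) dl (mkroot w s), w).
Proof.
elim: l a => [|s l IH] a; first by rewrite big_nil mulg1.
by rewrite big_cons mulgA -IH.
Qed.

Lemma run_tau l a w :
  run va_act (pos_word [seq va_tau s | s <- l]) (a, w) =
  (a, w * \prod_(s <- l) g s).
Proof.
elim: l w => [|s l IH] w; first by rewrite big_nil mulg1.
by rewrite big_cons mulgA -IH.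
Qed.

(** (VA1) becomes the braid relation between [w alpha_s] and [w alpha_t], (VA2) holds in [W], and
    (VA3) is [mkroot_va3]. *)
Lemma va_act_rel u v o : va_rel m u v -> run va_act u o = run va_act v o.
Proof.
case: o => a w [s t k st mk|s t k st mk|s|s t k st mk].
- rewrite !map_alt !run_sigma !prod_alt.
  have rst : mkroot w s != mkroot w t.
    by apply: contraNneq st => /(congr1 reflection)/reflection_inj ->.
  have mrk : root_matrix (mkroot w s) (mkroot w t) = Some k.
    by apply/root_entryP; exists w, s, t.
  by rewrite (artin_altw rst mrk); case: odd.
- by rewrite !map_alt !run_tau (cox_braid st mk).
- by rewrite /= /va_act /= -mulgA cox_genK mulg1.
- rewrite /pos_word -cats1 map_cat run_cat map_alt run_tau /= -/(pos_word _).
  by rewrite run_tau /va_act /= (mkroot_va3 w st mk).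
Qed.

Definition va_run (x : V) (o : A * W) : A * W := run va_act (repr x) o.

Lemma va_run_wclass u o : va_run (wclass (va_rel m) u) o = run va_act u o.
Proof.
apply: (run_wclass (R := va_rel m) (Dom := fun=> True)) => //.
- by move=> ? ? ? _; exact: va_actK.
- by move=> ? ? ? ? _; exact: va_act_rel.
- exact: wclass_repr.
Qed.

Lemma va_runM x y o : va_run (x * y) o = va_run y (va_run x o).
Proof.
by rewrite -(wclass_repr x) -(wclass_repr y) -wclass_cat !va_run_wclass run_cat.
Qed.

Lemma va_run1 o : va_run 1 o = o.
Proof. by rewrite -(wclass_nil (va_rel m)) va_run_wclass. Qed.

Lemma va_run_iota v a w : va_run (iota v) (a, w) = (a, w * v).
Proof.
rewrite -(wclass_repr v); elim: (repr v) w => [|l u IH] w.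
  by rewrite wclass_nil iota1 va_run1 mulg1.
rewrite cox_wclass_cons iotaM va_runM iota_gen va_run_wclass /= /va_act /=.
by rewrite IH mulgA.
Qed.

Lemma va_run_sigma s a w :
  va_run (sigma s) (a, w) = (a * dl (mkroot w s), w).
Proof. exact: va_run_wclass [:: (va_sigma s, false)] _. Qed.

(** The action reads [x] off [theta x], which yields injectivity of [theta]. *)
Lemma va_run_theta x a : va_run (theta x) (a, 1) = (a * x, 1).
Proof.
elim/artin_ind: x a => [|w s b x IH] a; first by rewrite theta1 va_run1 mulg1.
have e c : va_run (theta (dl (mkroot w s))) (c, 1) = (c * dl (mkroot w s), 1).
  rewrite theta_mkroot conjgE invgK !va_runM va_run_iota mul1g va_run_sigma.
  by rewrite -iotaV va_run_iota mulgV.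
rewrite thetaM va_runM; case: b; last by rewrite e IH mulgA.
(* For an inverse letter, [a] is written as [a d^-1 d] with [d] the generator, so that the run of
   [theta d] cancels. *)
rewrite -[in LHS](mulgVK (dl (mkroot w s)) a) -e -(va_runM (theta (dl _))).
rewrite thetaV mulgV va_run1.
by rewrite IH mulgA.
Qed.

Lemma theta_inj : injective theta.
Proof.
move=> x y e; have := va_run_theta x 1.
by rewrite e va_run_theta !mul1g => -[].
Qed.

Definition theta_ker (x : A) : KVA m := InKVA (introT eqP (piK_theta x)).

Lemma theta_kerM : {morph theta_ker : x y / x * y}.
Proof. by move=> x y; apply: val_inj; rewrite gmulfM; exact: thetaM. Qed.

Lemma theta_ker_inj : injective theta_ker.
Proof. by move=> x y /(congr1 val)/theta_inj. Qed.

Lemma theta_ker_surj y : exists x, theta_ker x = y.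
Proof.
case: y => y ky; have [a [w e]] := theta_iota_surj y.
exists a; apply: val_inj => /=; rewrite e.
move: (ky) => /eqP; rewrite e piKM piK_theta mul1g piK_iota => ->.
by rewrite iota1 mulg1.
Qed.
End KernelPresentation.

Theorem theorem3p7 (S : countType) (m : coxeter_matrix S) :
  cox_connected m -> indecomposable (KVA m).
Proof.
move=> conn; apply: (indecomposable_iso (@theta_kerM S m) (@theta_ker_inj S m)
  (@theta_ker_surj S m)).
apply: artin_indecomposable; first exact: root_partner.
by move=> U; exact: root_connected.
Qed.
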